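(* Let $q$ be a prime power. Then the full automorphism group (over $\mathbb K$) of the Pellikaan curve $\mathcal X_q$ is $$\mathrm{Aut}(\mathcal X_q)=S\rtimes C_3,$$ where $S=\langle\sigma\rangle$ and $C_3=\langle\tau\rangle$.
   Context: $\mathbb K$ is the algebraic closure of $\mathbb F_q$. The Pellikaan curve $\mathcal X_q$ is the nonsingular plane projective curve over $\mathbb K$ with affine equation $xy^{q+1}+x^{q+1}+y=0$, i.e. with homogeneous equation $X_0X_1^{q+1}+X_0^{q+1}X_2+X_1X_2^{q+1}=0$, where $x=X_0/X_2$, $y=X_1/X_2$. Let $\lambda\in\mathbb K$ be a primitive $(q^2+q+1)$-th root of unity, and let $\sigma,\tau$ be the linear collineations $$\sigma:(X_0,X_1,X_2)\mapsto(X_0,\lambda X_1,\lambda^{q+1}X_2),\qquad \tau:(X_0,X_1,X_2)\mapsto(X_2,X_0,X_1),$$ which preserve $\mathcal X_q$; they are regarded as elements of $\mathrm{Aut}(\mathcal X_q)$. $\mathrm{Aut}(\mathcal X_q)$ denotes the group of all $\mathbb K$-automorphisms of $\mathcal X_q$ (all of which are induced by elements of $PGL(3,\mathbb K)$, since $\mathcal X_q$ is a nonsingular plane curve of degree $q+2\geq 4$).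
   Formalization: The case q = 2 is excluded: there the Pellikaan curve is the Klein quartic in characteristic 2, whose automorphism group has order 168 rather than 21, so the claim fails; all prime powers q ≥ 3 are covered. *)

(* Defs.v *)
From HB Require Import structures.
From mathcomp Require Import all_boot all_order all_algebra.
From mathcomp Require Import boolp mpoly zify ring.

Set Implicit Arguments.
Unset Strict Implicit.
Unset Printing Implicit Defensive.

Import GRing.Theory.
Local Open Scope ring_scope.

Section Groups.
Local Open Scope group_scope.
Variable G : groupType.

Definition subgroup (H : G -> Prop) : Prop :=
  H 1 /\ forall x y, H x -> H y -> H (x / y).

Definition cyclic_subgroup (x : G) : G -> Prop :=
  fun g => exists n : nat, g = x ^+ n \/ g = x ^- n.

(* [semidirect N H]: the whole group [G] is the internal product N ><| H. *)
Record semidirect (N H : G -> Prop) : Prop := Semidirect {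
  semidirect_subl : subgroup N;
  semidirect_subr : subgroup H;
  semidirect_normal : forall x g, N x -> N (x ^ g);
  semidirect_trivial : forall x, N x -> H x -> x = 1;
  semidirect_full : forall g, exists x y, [/\ N x, H y & g = x * y]
}.

End Groups.

Section ProjectivePlane.
Variable K : closedFieldType.

Definition pplane := {U : {vspace 'rV[K]_3} | \dim U == 1%N}.

(* A nonzero vector of homogeneous coordinates of [P]. *)
Definition coords (P : pplane) : 'rV[K]_3 := vpick (val P).

Definition feval (f : {mpoly K[3]}) (v : 'rV[K]_3) : K := f.@[v 0].

Definition feval3 (A : 'I_3 -> {mpoly K[3]}) (v : 'rV[K]_3) : 'rV[K]_3 :=
  \row_i feval (A i) v.

Lemma coordsE P : val P = <[coords P]>%VS.
Proof.
have dP := eqP (valP P); apply/eqP; rewrite eq_sym eqEdim.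
rewrite -memvE memv_pick dP dim_vline /= /coords vpick0 -dimv_eq0.
by rewrite dP.
Qed.

Lemma coords_neq0 P : coords P != 0.
Proof. by rewrite vpick0 -dimv_eq0 (eqP (valP P)). Qed.

Lemma point_subproof (v : 'rV[K]_3) (v0 : v != 0) : \dim <[v]>%VS == 1%N.
Proof. by rewrite dim_vline v0. Qed.

Definition point (v : 'rV[K]_3) (v0 : v != 0) : pplane :=
  exist _ <[v]>%VS (point_subproof v0).

Lemma feval_scale d (f : {mpoly K[3]}) c v :
  f \is d.-homog -> feval f (c *: v) = c ^+ d * feval f v.
Proof.
move=> hf; rewrite /feval !mevalE mulr_sumr !big_seq; apply: eq_bigr => m mf.
rewrite mulrCA; congr (_ * _).
under eq_bigr => i _ do rewrite mxE exprMn.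
rewrite big_split /= prodrXr; congr (_ ^+ _ * _).
by have /= <- := dhomog_mf hf mf; rewrite mdegE.
Qed.

Lemma feval3_scale d (A : 'I_3 -> {mpoly K[3]}) c v :
  (forall i, A i \is d.-homog) -> feval3 A (c *: v) = c ^+ d *: feval3 A v.
Proof.
by move=> hA; apply/rowP=> i; rewrite !mxE; apply: feval_scale.
Qed.

Definition fcomp3 (f : {mpoly K[3]}) (A : 'I_3 -> {mpoly K[3]}) : {mpoly K[3]} :=
  f \mPo [tuple A i | i < 3].

Lemma feval_comp f A v : feval (fcomp3 f A) v = feval f (feval3 A v).
Proof.
rewrite /feval comp_mpoly_meval; apply: meval_eq => i.
by rewrite tnth_mktuple mxE.
Qed.

Lemma fcomp3_homog d e f (A : 'I_3 -> {mpoly K[3]}) :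
  f \is e.-homog -> (forall i, A i \is d.-homog) ->
  fcomp3 f A \is (d * e).-homog.
Proof.
move=> hf hA; rewrite /fcomp3 comp_mpolyE big_seq; apply: rpred_sum => m mf.
apply: rpredZ; have /= <- := dhomog_mf hf mf; rewrite mdegE big_distrr /=.
elim/big_ind2: _ => [|a p b r|i _]; first exact: dhomog1.
  exact: dhomogM.
by rewrite tnth_mktuple; apply: dhomogMn.
Qed.

End ProjectivePlane.

Section PlaneCurve.
Variables (K : closedFieldType) (F : {mpoly K[3]}).

Definition curve := {P : pplane K | feval F (coords P) == 0}.

Definition ccoords (P : curve) : 'rV[K]_3 := coords (val P).

(* Near every point of the curve (off the zero locus of a form [h]), [phi] is
   given by three forms of equal degree; they have no common zero there, since
   [val (val (phi Q))] has dimension 1. *)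
Definition regular (phi : curve -> curve) : Prop :=
  forall P : curve, exists (d e : nat) (A : 'I_3 -> {mpoly K[3]}) (h : {mpoly K[3]}),
    [/\ forall i, A i \is d.-homog, h \is e.-homog, feval h (ccoords P) != 0 &
        forall Q : curve, feval h (ccoords Q) != 0 ->
          val (val (phi Q)) = <[feval3 A (ccoords Q)]>%VS].

(* [F] is arbitrary here: the curve is the reduced projective variety F = 0. *)
Record curve_aut := CurveAut {
  aut_fun :> curve -> curve;
  aut_inv : curve -> curve;
  aut_funK : cancel aut_fun aut_inv;
  aut_invK : cancel aut_inv aut_fun;
  aut_regular : regular aut_fun;
  aut_inv_regular : regular aut_inv
}.

Lemma curve_autP (f g : curve_aut) : f =1 g -> f = g.
Proof.
case: f g => [f f' fK f'K rf rf'] [g g' gK g'K rg rg'] /= /funext efg.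
subst g; have eg : f' = g' by apply/funext => x; rewrite -[x in LHS]g'K fK.
by subst g'; congr CurveAut; apply: Prop_irrelevance.
Qed.

Lemma curveP (P Q : curve) : val (val P) = val (val Q) -> P = Q.
Proof. by move/val_inj/val_inj. Qed.

Lemma vline_scale (c : K) (v : 'rV[K]_3) : c != 0 -> (<[c *: v]> = <[v]>)%VS.
Proof.
move=> c0; apply/eqP; rewrite eqEdim -memvE memvZ ?memv_line //=.
by rewrite !dim_vline scaler_eq0 (negPf c0).
Qed.

Lemma vline_eq (v w : 'rV[K]_3) :
  (<[v]> = <[w]>)%VS -> v != 0 -> exists2 c, c != 0 & v = c *: w.
Proof.
move=> evw v0; have /vlineP[c vE] : v \in <[w]>%VS by rewrite -evw memv_line.
exists c => //; apply: contraNneq v0 => c0; by rewrite vE c0 scale0r.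
Qed.

Lemma regular_id : regular id.
Proof.
move=> P; exists 1%N, 0%N, (fun i => 'X_i), 1; split=> [i|||Q _].
- by rewrite dhomogX /= mdeg1.
- exact: dhomog1.
- by rewrite /feval meval1 oner_neq0.
rewrite coordsE; congr <[_]>%VS; apply/rowP=> i.
by rewrite mxE /feval mevalXU.
Qed.

Lemma regular_comp f g : regular f -> regular g -> regular (f \o g).
Proof.
move=> rf rg P.
have [d [e [A [h [hA hh hP AE]]]]] := rg P.
have [d' [e' [B [k [hB hk kP BE]]]]] := rf (g P).
have gE Q : feval h (ccoords Q) != 0 ->
  exists2 c, c != 0 & ccoords (g Q) = c *: feval3 A (ccoords Q).
  by move=> hQ; apply: vline_eq (coords_neq0 _); rewrite -coordsE AE.
exists (d * d')%N, (e + d * e')%N, (fun i => fcomp3 (B i) A), (h * fcomp3 k A).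
have kE Q c : ccoords (g Q) = c *: feval3 A (ccoords Q) ->
  feval k (ccoords (g Q)) = c ^+ e' * feval (fcomp3 k A) (ccoords Q).
  by move=> cE; rewrite cE (feval_scale _ _ hk) feval_comp.
have hkE Q : feval (h * fcomp3 k A) (ccoords Q) =
    feval h (ccoords Q) * feval (fcomp3 k A) (ccoords Q).
  by rewrite /feval mevalM.
split=> [i|||Q].
- by apply: fcomp3_homog.
- by apply: dhomogM => //; apply: fcomp3_homog.
- rewrite hkE mulf_neq0 //; have [c c0 cE] := gE P hP.
  by apply: contraNneq kP => z; rewrite (kE _ _ cE) z mulr0.
rewrite hkE mulf_eq0 negb_or => /andP[hQ kQ] /=.
have [c c0 cE] := gE Q hQ.
rewrite BE; last by rewrite (kE _ _ cE) mulf_neq0 ?expf_neq0.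
rewrite cE (feval3_scale _ _ hB) vline_scale ?expf_neq0 //.
congr <[_]>%VS; apply/rowP=> i; by rewrite !mxE feval_comp.
Qed.

Definition aut_one : curve_aut :=
  CurveAut (frefl _) (frefl _) regular_id regular_id.

Definition aut_comp (f g : curve_aut) : curve_aut :=
  CurveAut (can_comp (aut_funK f) (aut_funK g))
    (can_comp (aut_invK g) (aut_invK f))
    (regular_comp (aut_regular f) (aut_regular g))
    (regular_comp (aut_inv_regular g) (aut_inv_regular f)).

Definition aut_symm (f : curve_aut) : curve_aut :=
  CurveAut (aut_invK f) (aut_funK f) (aut_inv_regular f) (aut_regular f).

Fact aut_compA : associative aut_comp.
Proof. by move=> f g h; apply: curve_autP. Qed.
Fact aut_comp1 : left_id aut_one aut_comp.
Proof. by move=> f; apply: curve_autP. Qed.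
Fact aut_1comp : right_id aut_one aut_comp.
Proof. by move=> f; apply: curve_autP. Qed.
Fact aut_Vcomp : left_inverse aut_one aut_symm aut_comp.
Proof. by move=> f; apply: curve_autP => x; apply: aut_funK. Qed.
Fact aut_compV : right_inverse aut_one aut_symm aut_comp.
Proof. by move=> f; apply: curve_autP => x; apply: aut_invK. Qed.

HB.instance Definition _ := gen_eqMixin curve_aut.
HB.instance Definition _ := gen_choiceMixin curve_aut.
HB.instance Definition _ := isGroup.Build curve_aut
  aut_compA aut_comp1 aut_1comp aut_Vcomp aut_compV.

End PlaneCurve.

Section LinearAut.
Variables (K : closedFieldType) (F : {mpoly K[3]}) (d : nat).
Hypothesis F_homog : F \is d.-homog.

Definition preserves (M : 'M[K]_3) : Prop :=
  exists2 c : K, c != 0 & forall v, feval F (v *m M) = c * feval F v.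

Lemma preservesV M : M \in unitmx -> preserves M -> preserves (invmx M).
Proof.
move=> uM [c c0 cE]; exists c^-1; rewrite ?invr_eq0 // => v.
by rewrite -[v in RHS](mulmxKV uM) cE mulKf.
Qed.

Lemma mulmx_unit_neq0 (M : 'M[K]_3) (v : 'rV_3) :
  M \in unitmx -> v != 0 -> v *m M != 0.
Proof.
by move=> uM; apply: contraNneq => vM0; rewrite -(mulmxK uM v) vM0 mul0mx.
Qed.

Lemma lin_fun_subproof M (uM : M \in unitmx) (pM : preserves M) (P : curve F) :
  feval F (coords (point (mulmx_unit_neq0 uM (coords_neq0 (val P))))) == 0.
Proof.
set w := point _; have /esym := coordsE w.
move=> /vline_eq /(_ (coords_neq0 _))[c _ ->].
rewrite (feval_scale _ _ F_homog); have [b _ ->] := pM.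
by rewrite (eqP (valP P)) !mulr0.
Qed.

Definition lin_fun M (uM : M \in unitmx) (pM : preserves M) (P : curve F) :
  curve F :=
  exist (fun Q => feval F (coords Q) == 0) _ (lin_fun_subproof uM pM P).

Lemma lin_funK M N (uM : M \in unitmx) (pM : preserves M)
  (uN : N \in unitmx) (pN : preserves N) :
  M *m N = 1%:M -> cancel (lin_fun uM pM) (lin_fun uN pN).
Proof.
move=> MN P; apply: curveP => /=; set w := point _.
have /esym := coordsE w; move=> /vline_eq /(_ (coords_neq0 _))[c c0 wE].
rewrite [X in <[X *m N]>%VS]wE -scalemxAl vline_scale // -mulmxA MN mulmx1.
exact/esym/coordsE.
Qed.

Lemma lin_fun_regular M (uM : M \in unitmx) (pM : preserves M) :
  regular (lin_fun uM pM).
Proof.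
move=> P; exists 1%N, 0%N, (fun i => \sum_j M j i *: 'X_j), 1.
split=> [i|||Q _].
- by apply: rpred_sum => j _; apply: rpredZ; rewrite dhomogX /= mdeg1.
- exact: dhomog1.
- by rewrite /feval meval1 oner_neq0.
congr <[_]>%VS; apply/rowP=> i; rewrite !mxE /feval raddf_sum /=.
by apply: eq_bigr => j _; rewrite mevalZ mevalXU mulrC.
Qed.

(* The automorphism of the curve induced by the collineation v |-> v *m M. *)
Definition lin_aut M (uM : M \in unitmx) (pM : preserves M) : curve_aut F :=
  let uM' : invmx M \in unitmx := etrans (unitmx_inv M) uM in
  let pM' := preservesV uM pM in
  CurveAut (lin_funK uM pM uM' pM' (mulmxV uM))
    (lin_funK uM' pM' uM pM (mulVmx uM))
    (lin_fun_regular uM pM) (lin_fun_regular uM' pM').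

End LinearAut.

Section Pellikaan.
Variables (K : closedFieldType) (q : nat).

Definition X0 : {mpoly K[3]} := 'X_(inord 0).
Definition X1 : {mpoly K[3]} := 'X_(inord 1).
Definition X2 : {mpoly K[3]} := 'X_(inord 2).

Definition pellikaan : {mpoly K[3]} :=
  X0 * X1 ^+ q.+1 + X0 ^+ q.+1 * X2 + X1 * X2 ^+ q.+1.

Definition row3 (a b c : K) : 'rV[K]_3 := \row_i [:: a; b; c]`_i.

Lemma row3E (v : 'rV[K]_3) :
  v = row3 (v 0 (inord 0)) (v 0 (inord 1)) (v 0 (inord 2)).
Proof.
apply/rowP=> i; rewrite mxE -[i in LHS]inord_val.
by case: i => [[|[|[|]]]].
Qed.

Lemma feval_pellikaan a b c :
  feval pellikaan (row3 a b c) = a * b ^+ q.+1 + a ^+ q.+1 * c + b * c ^+ q.+1.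
Proof.
by rewrite /feval /pellikaan !(rmorphD, rmorphM, rmorphXn) /= !mevalXU !mxE !inordK.
Qed.

Lemma pellikaan_homog : pellikaan \is q.+2.-homog.
Proof.
have hX i : ('X_i : {mpoly K[3]}) \is 1.-homog by rewrite dhomogX /= mdeg1.
have hXn i : ('X_i ^+ q.+1 : {mpoly K[3]}) \is q.+1.-homog.
  by have := dhomogMn q.+1 (hX i); rewrite mul1n.
apply: rpredD; first apply: rpredD.
- exact: (dhomogM (hX _) (hXn _)).
- by rewrite -[q.+2]addn1; exact: (dhomogM (hXn _) (hX _)).
- exact: (dhomogM (hX _) (hXn _)).
Qed.

Definition tau_mx : 'M[K]_3 := \matrix_i
  [:: row3 0 1 0; row3 0 0 1; row3 1 0 0]`_i.

Lemma tau_mxE a b c : row3 a b c *m tau_mx = row3 c a b.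
Proof.
apply/rowP=> j; rewrite !mxE !big_ord_recl big_ord0 !mxE.
by case: j => [[|[|[|]]]] //= ?; rewrite ?mxE /=; ring.
Qed.

Lemma tau_unit : tau_mx \in unitmx.
Proof.
have : tau_mx *m (tau_mx *m tau_mx) = 1%:M.
  apply/row_matrixP=> i; rewrite !rowE mulmx1 !mulmxA.
  by rewrite [delta_mx _ _]row3E !tau_mxE.
by case/mulmx1_unit.
Qed.

Lemma tau_preserves : preserves pellikaan tau_mx.
Proof.
exists 1; rewrite ?oner_eq0 // => v.
rewrite [v]row3E tau_mxE !feval_pellikaan mul1r.
ring.
Qed.

Definition tau : curve_aut pellikaan :=
  lin_aut pellikaan_homog tau_unit tau_preserves.

Variable lam : K.

Definition sigma_mx : 'M[K]_3 := diag_mx (row3 1 lam (lam ^+ q.+1)).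

Lemma sigma_mxE a b c :
  row3 a b c *m sigma_mx = row3 a (lam * b) (lam ^+ q.+1 * c).
Proof.
apply/rowP=> j; rewrite mul_mx_diag !mxE.
by case: j => [[|[|[|]]]] //= _; rewrite ?mulr1 // mulrC.
Qed.

Hypothesis lam_prim : (q ^ 2 + q + 1).-primitive_root lam.

Lemma lam_neq0 : lam != 0.
Proof.
apply/eqP => l0; have := prim_expr_order lam_prim.
by rewrite l0 addn1 expr0n => /eqP; rewrite eq_sym oner_eq0.
Qed.

Lemma sigma_unit : sigma_mx \in unitmx.
Proof.
rewrite unitmxE det_diag !big_ord_recl big_ord0 !mxE /= mul1r mulr1.
by rewrite unitfE mulf_neq0 ?expf_neq0 ?lam_neq0.
Qed.

Lemma sigma_preserves : preserves pellikaan sigma_mx.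
Proof.
exists (lam ^+ q.+1); first by rewrite expf_neq0 ?lam_neq0.
move=> v; rewrite [v]row3E sigma_mxE !feval_pellikaan.
set a := v 0 _; set b := v 0 _; set c := v 0 _.
have lE : lam * (lam ^+ q.+1) ^+ q.+1 = lam ^+ q.+1.
  rewrite -[RHS]mulr1 -(prim_expr_order lam_prim) -exprM -exprS -exprD.
  by congr (_ ^+ _); lia.
rewrite !exprMn; transitivity (lam ^+ q.+1 * (a * b ^+ q.+1 + a ^+ q.+1 * c)
    + lam * (lam ^+ q.+1) ^+ q.+1 * (b * c ^+ q.+1)).
  by ring.
by rewrite lE -mulrDr.
Qed.

Definition sigma : curve_aut pellikaan :=
  lin_aut pellikaan_homog sigma_unit sigma_preserves.

End Pellikaan.

(* Main.v *)
From mathcomp Require Import all_boot all_algebra all_solvable all_field.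
From mathcomp Require Import boolp mpoly zify ring.
Require Import Defs.

(** Put x = X0/X2, y = X1/X2 and u = x^(q+1)/y.  Off the vertices
    e0 = (1:0:0), e1 = (0:1:0), e2 = (0:0:1) of the coordinate triangle the
    equation reads 1 + u = - x y^q, whence x^N = - u^q (1 + u) with
    N = q^2 + q + 1, and y = x^(q+1)/u.  So u exhibits the curve as a cyclic
    cover of the line with group S = <sigma>, totally ramified over u = oo, 0
    and -1, that is at e0, e1 and e2.  Functions are studied through their
    S-eigencomponents, which are explicit up to polynomials in u; this takes
    the place of divisors, of differentials and of the Riemann-Roch theorem.

    Every automorphism phi permutes e0, e1, e2 ([inner_preimage_absurd]).
    Indeed x has its only pole at e0, of order q+1.  If phi maps another point
    P0, off the triangle, to e0, then f = x o phi has a pole of order q+1 at P0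
    and no other.  As F = X0^q Q0 + X1^q Q1 + X2^q Q2 with quadratic Qi, near
    P0 the curve agrees up to order q >= 3 with a smooth conic, so that the
    tangent T at P0 meets it with multiplicity exactly 2, and some product G of
    at most q-1 linear forms vanishes at P0 to order exactly q.  The differential
    f G x / (u (1 + u)) du would have a simple pole at P0 and no other pole,
    against the residue theorem.  The latter is proved by averaging over S:
    (u - u(P0)) f G x becomes a polynomial in u which vanishes at 0 and -1, has
    degree at most 1, and is not zero at u(P0).

    It follows that the stabiliser of e0 is S ([stabiliser_e0]).  If phi fixes
    e0, then x o phi / x has a value a at e0, so x o phi - a x has a smaller
    pole at e0 than x, and such a function is constant ([constant_of_pole]).
    Hence x o phi = a x; comparing orders of vanishing, phi fixes e1 and e2;
    then y o phi / y has no pole, so it is constant as well; and the equation of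
    the curve leaves only the powers of sigma.  Finally tau permutes e0, e1, e2
    cyclically, so each automorphism is a power of sigma times one of tau, while
    S is normal because it consists of the automorphisms that fix every
    vertex. *)

Set Implicit Arguments.
Unset Strict Implicit.
Unset Printing Implicit Defensive.

Import GRing.Theory.
Local Open Scope ring_scope.

Section Curve.
Variables (K : closedFieldType) (q : nat) (lam : K).
Hypothesis q_gt2 : (2 < q)%N.
Hypothesis q_pchar : [pchar K].-nat q.
Let N := (q ^ 2 + q + 1)%N.
Hypothesis lam_prim : N.-primitive_root lam.

(** * The affine model x^N = - u^q (1 + u) *)

(** The eigenvalue of sigma on x. *)
Definition zeta := lam ^+ (q ^ 2).

Lemma zeta_prim : N.-primitive_root zeta.
Proof.
rewrite prim_root_exp_coprime // coprimeXl //.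
have -> : N = (q.+1 * q + 1)%N by rewrite /N; nia.
by rewrite -coprime_modr modnMDl coprime_modr coprimen1.
Qed.

Lemma natr_q : q%:R = 0 :> K.
Proof.
have q1 : (1 < q)%N by apply: ltnW.
have [m ->] := dvdnP (pdiv_dvd q).
have /pnatP/(_ (pdiv q))/(_ (pdiv_prime q1) (pdiv_dvd q)) := q_pchar.
by move=> /(_ (ltnW q1)) /pcharf0 p0; rewrite natrM p0 mulr0.
Qed.

Lemma frobeniusB (a b : K) : (a - b) ^+ q = a ^+ q - b ^+ q.
Proof. by rewrite exprDn_pchar // exprNn_pchar. Qed.

Lemma natr_order : N%:R = 1 :> K.
Proof. by rewrite /N !natrD natrX natr_q; ring. Qed.

(** Its zeros 0 and -1 are the finite branch points of u. *)
Definition branch : {poly K} := - 'X^q * (1 + 'X).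

Lemma branchE u : branch.[u] = - u ^+ q * (1 + u).
Proof. by rewrite /branch !hornerE. Qed.

(** The points over the unramified values of u; the point (0, -1), excluded
    here, is the model of e2. *)
Definition model (x u : K) : Prop := [/\ u != 0, u != -1 & x ^+ N = branch.[u]].

Definition eval2 (R : {poly {poly K}}) (x u : K) : K := R.[x%:P].[u].

Lemma eval2E R x u : eval2 R x u = \sum_(i < size R) (R`_i).[u] * x ^+ i.
Proof.
rewrite /eval2 (horner_coef R) horner_sum; apply: eq_bigr => i _.
by rewrite hornerM horner_exp hornerC.
Qed.

Lemma eval2_x0 u R : eval2 R 0 u = (R`_0).[u].
Proof. by rewrite /eval2 (horner_coef0 R). Qed.

Lemma model_neq0 x u : model x u -> x != 0.
Proof.
case=> u0 u1 e; apply: contraNneq u1 => x0; move/eqP: e.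
rewrite x0 branchE expr0n /N addn1 /= eq_sym mulf_eq0 oppr_eq0 expf_eq0.
by rewrite (negPf u0) andbF /= addrC addr_eq0.
Qed.

Lemma model_rot x u s : model x u -> model (zeta ^+ s * x) u.
Proof.
case=> u0 u1 e; split=> //.
by rewrite exprMn exprAC (prim_expr_order zeta_prim) expr1n mul1r.
Qed.

Lemma sum_root_unity i : \sum_(s < N) (zeta ^+ s) ^+ i = (N %| i)%N%:R.
Proof.
have E s : (zeta ^+ s) ^+ i = (zeta ^+ i) ^+ s by rewrite exprAC.
under eq_bigr do rewrite E.
have [d | nd] := boolP (N %| i)%N.
  have z1 : zeta ^+ i = 1 by apply/eqP; rewrite -(prim_order_dvd zeta_prim).
  under eq_bigr do rewrite z1 expr1n.
  by rewrite sumr_const card_ord natr_order.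
have z1 : zeta ^+ i - 1 != 0 by rewrite subr_eq0 -(prim_order_dvd zeta_prim).
apply: (mulfI z1); rewrite -subrX1 mulr0 exprAC.
by rewrite (prim_expr_order zeta_prim) expr1n subrr.
Qed.

(** Summing over x |-> zeta x multiplies the monomials in x^N by N, which is 1
    in K, and kills the others; and x^N is a polynomial in u.  The value at
    (0, -1), a fixed point, is unchanged. *)
Lemma orbit_average R : exists p : {poly K},
  (forall x u, x ^+ N = branch.[u] ->
     \sum_(s < N) eval2 R (zeta ^+ s * x) u = p.[u]) /\
  p.[-1] = eval2 R 0 (-1).
Proof.
exists (\sum_(i < size R | (N %| i)%N) R`_i * branch ^+ (i %/ N)); split.
  move=> x u e; under eq_bigr do rewrite eval2E.
  rewrite exchange_big /= [in RHS]big_mkcond horner_sum; apply: eq_bigr => i _ /=.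
  under eq_bigr do rewrite exprMn mulrCA.
  rewrite -mulr_suml sum_root_unity; case: ifP => [d|_]; last by rewrite mul0r horner0.
  by rewrite mul1r hornerM horner_exp -e -exprM mulnC divnK.
have b0 : branch.[-1] = 0 by rewrite branchE subrr mulr0.
rewrite eval2_x0 horner_sum big_mkcond /=.
have [->|R0] := eqVneq R 0; first by rewrite size_poly0 big_ord0 coef0 horner0.
have sR : (0 < size R)%N by rewrite size_poly_gt0.
rewrite (bigD1 (Ordinal sR)) //= dvdn0 div0n expr0 mulr1.
rewrite big1 ?addr0 // => i i0; case: ifP => // d.
rewrite hornerM horner_exp b0 expr0n.
have : (0 < i)%N by rewrite lt0n; apply: contraNneq i0 => i0; apply/eqP/val_inj.
move=> /dvdn_leq /(_ d) Ni; rewrite eqn0Ngt divn_gt0 ?Ni ?mulr0 //.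
by rewrite /N addn1.
Qed.

Lemma poly_eq0_unramified (p : {poly K}) :
  (forall u, u != 0 -> u != -1 -> p.[u] = 0) -> p = 0.
Proof.
move=> h; apply/eqP/contraT => p0.
have : p * ('X * ('X + 1%:P)) != 0 :> {poly K}.
  rewrite !mulf_neq0 ?polyX_eq0 // -[_ + _]opprK oppr_eq0 opprD.
  by rewrite -size_poly_gt0 -opprD size_polyN size_XaddC.
move/closed_nonrootP => [u]; rewrite rootE !hornerM hornerX hornerD hornerX hornerC.
rewrite !mulf_eq0 !negb_or => /andP[pu /andP[u0 u1]].
by rewrite h ?eqxx // -addr_eq0 in pu.
Qed.

Lemma model_ex u : u != 0 -> u != -1 -> exists x, model x u.
Proof.
move=> u0 u1; have /closed_rootP[x] : size ('X^N - (branch.[u])%:P) != 1.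
  by rewrite size_XnsubC /N addn1.
rewrite rootE hornerD hornerN hornerXn hornerC subr_eq0 => /eqP e; by exists x; split.
Qed.

(** Fourier inversion over S: R is the sum of its eigencomponents, and each of
    these becomes S-invariant when it is multiplied by a power of x. *)
Lemma eval2_components R x u : model x u ->
  eval2 R x u = \sum_(i < N) x ^- i * \sum_(s < N) eval2 ('X^i * R) (zeta ^+ s * x) u.
Proof.
move=> m; have x0 := model_neq0 m.
have E i s : eval2 ('X^i * R) (zeta ^+ s * x) u
   = (zeta ^+ s) ^+ i * x ^+ i * eval2 R (zeta ^+ s * x) u.
  by rewrite /eval2 hornerM hornerXn -polyC_exp hornerM hornerC exprMn.
have Nne : (0 < N)%N by rewrite /N addn1.
transitivity (\sum_(s < N) \sum_(i < N) (zeta ^+ i) ^+ s * eval2 R (zeta ^+ s * x) u).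
  under eq_bigr do rewrite -mulr_suml sum_root_unity.
  rewrite (bigD1 (Ordinal Nne)) //= dvdn0 expr0 !mul1r big1 ?addr0 // => s s0.
  have : (0 < s)%N by rewrite lt0n; apply: contraNneq s0 => i0; apply/eqP/val_inj.
  move=> s_gt0; rewrite (_ : (N %| s)%N = false) ?mul0r //; apply/negP.
  by move/(dvdn_leq s_gt0); rewrite leqNgt ltn_ord.
rewrite exchange_big; apply: eq_bigr => i _; rewrite mulr_sumr.
apply: eq_bigr => s _; rewrite E; rewrite exprAC !mulrA; congr (_ * _).
by rewrite mulrAC mulVf ?mul1r ?expf_neq0.
Qed.

Lemma nonzero_component R : (exists x u, model x u /\ eval2 R x u != 0) ->
  exists i (p : {poly K}), p != 0 /\ forall x u, x ^+ N = branch.[u] ->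
     \sum_(s < N) eval2 ('X^i * R) (zeta ^+ s * x) u = p.[u].
Proof.
case=> x [u [m]]; rewrite (eval2_components _ m) => nz.
have [i hi] : exists i : 'I_N,
    \sum_(s < N) eval2 ('X^i * R) (zeta ^+ s * x) u != 0.
  apply/existsP; apply: contraNT nz; rewrite negb_exists => /forallP z.
  by apply/eqP/big1 => i _; have := z i; rewrite negbK => /eqP ->; rewrite mulr0.
exists i; have [p [pE _]] := orbit_average ('X^i * R); exists p; split=> //.
apply: contraNneq hi => p0; rewrite pE ?p0 ?horner0 //; by case: m.
Qed.

(** Averaging reduces this to a polynomial in u, which has infinitely many
    zeros: the point (0, -1) is in the closure of the others. *)
Lemma eval2_origin R : (forall x u, model x u -> eval2 R x u = 0) -> eval2 R 0 (-1) = 0.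
Proof.
move=> h; have [p [pE <-]] := orbit_average R.
suff -> : p = 0 by rewrite horner0.
apply: poly_eq0_unramified => u u0 u1; have [x m] := model_ex u0 u1.
rewrite -(pE x); last by case: m.
by apply: big1 => s _; apply/h/model_rot.
Qed.

(** The order at e2, where x is a local parameter and 1 + u = - x^N / u^q: the
    eigencomponents of R have orders that differ modulo N, so one of them has the
    least order k, and R is x^k times a function that is not zero there. *)
Lemma eval2_leading_term R : (exists x u, model x u /\ eval2 R x u != 0) ->
  exists k L M R', eval2 R' 0 (-1) != 0 /\
    forall x u, model x u -> u ^+ M * (x ^+ L * eval2 R x u) = x ^+ k * eval2 R' x u.
Proof.
move=> nz.
have /choice[c cP] : forall i, exists p : {poly K}, forall x u, x ^+ N = branch.[u] ->
     \sum_(s < N) eval2 ('X^i * R) (zeta ^+ s * x) u = p.[u].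
  by move=> i; have [p [pE _]] := orbit_average ('X^i * R); exists p.
have RE x u : model x u -> x ^+ N * eval2 R x u = \sum_(i < N) x ^+ (N - i) * (c i).[u].
  move=> m; rewrite (eval2_components R m) mulr_sumr; apply: eq_bigr => i _.
  rewrite cP; last by case: m.
  rewrite mulrA; congr (_ * _).
  apply: (mulIf (expf_neq0 i (model_neq0 m))).
  by rewrite divfK ?expf_neq0 ?(model_neq0 m) // -exprD subnK // ltnW.
have [i0 ci0] : exists i : 'I_N, c i != 0.
  apply/existsP; apply/contraT; rewrite negb_exists => /forallP z.
  case: nz => x [u [m /negP[]]].
  have xN : x ^+ N != 0 by rewrite expf_neq0 ?(model_neq0 m).
  rewrite -(mulrI_eq0 _ (mulfI xN)) RE // big1 // => i _.
  by have := z i; rewrite negbK => /eqP ->; rewrite horner0 mulr0.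
have /choice[d dP] : forall i, exists d : nat * {poly K},
    c i = d.2 * ('X + 1) ^+ d.1 /\ (c i != 0 -> d.2.[-1] != 0).
  move=> i; have [m [p pn0 pE]] := multiplicity_XsubC (c i) (-1).
  exists (m, p); split=> /=; first by rewrite pE polyCN opprK.
  by apply: (implyP pn0).
(* the order in x of the i-th component, after multiplication by x^N *)
pose e (i : 'I_N) := ((N - i) + N * (d i).1)%N.
pose j := [arg min_(i < i0 | c i != 0) e i].
have [cj jmin] : c j != 0 /\ forall i : 'I_N, c i != 0 -> (e j <= e i)%N.
  by rewrite /j; case: arg_minnP.
pose m := (\max_(i < N) (d i).1)%N.
have dm (i : 'I_N) : ((d i).1 <= m)%N by rewrite /m (leq_bigmax i).
pose R' := \sum_(i < N | c i != 0)
   ('X^(e i - e j) * ((-1) ^+ (d i).1 * (d i).2 * 'X^(q * (m - (d i).1)))%:P) : {poly {poly K}}.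
have R'E x u : eval2 R' x u = \sum_(i < N | c i != 0)
   x ^+ (e i - e j) * ((-1) ^+ (d i).1 * (d i).2.[u] * u ^+ (q * (m - (d i).1))).
  rewrite /eval2 /R' !horner_sum; apply: eq_bigr => i _.
  rewrite !hornerM hornerXn -polyC_exp !hornerC !hornerM hornerXn.
  by rewrite !horner_exp !hornerE.
have e_inj (i i' : 'I_N) : e i = e i' -> i = i'.
  rewrite /e => ee; apply/val_inj => /=.
  have := ltn_ord i; have := ltn_ord i'; move: ee.
  move: (d i).1 (d i').1 => a' b'.
  case: i i' => [a ?] [b ?] /=; move: N => n E an bn.
  have [h|h|h] := ltngtP a' b'; last 1 first.
  - by move: E; rewrite h; lia.
  - by have := leq_mul (leqnn n) h; lia.
  by have := leq_mul (leqnn n) h; lia.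
have key x u : model x u -> u ^+ (q * m) * (x ^+ N * eval2 R x u) = x ^+ e j * eval2 R' x u.
  move=> mo; have [u0 u1 xN] := mo.
  rewrite RE // R'E !mulr_sumr [RHS]big_mkcond /=; apply: eq_bigr => i _.
  case: ifP => [ci|/negbFE/eqP->]; last by rewrite horner0 !mulr0.
  rewrite [RHS]mulrA -[in RHS]exprD subnKC ?jmin // /e exprD (exprM x) xN branchE.
  have X1 : ('X + 1 : {poly K}).[u] = u + 1 by rewrite !hornerE.
  have [-> _] := dP i; rewrite hornerM horner_exp X1 {X1}.
  have -> : (q * m = q * (d i).1 + q * (m - (d i).1))%N.
    by rewrite -mulnDr subnKC.
  rewrite (exprD u) !(exprM u).
  move: ((d i).2.[u]) (u ^+ q) (x ^+ (N - i)) => D U X.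
  have s1 : (-1) ^+ (d i).1 * (-1) ^+ (d i).1 = 1 :> K by rewrite -exprMn mulrNN mulr1 expr1n.
  rewrite mulNr [(- (U * _)) ^+ _]exprNn exprMn [u + 1]addrC.
  transitivity (((-1) ^+ (d i).1 * (-1) ^+ (d i).1) *
     (U ^+ (d i).1 * U ^+ (m - (d i).1) * (X * (D * (1 + u) ^+ (d i).1)))).
    by rewrite s1 mul1r -!mulrA.
  by ring.
exists (e j), N, (q * m)%N, R'; split=> //.
rewrite R'E (bigD1 j) //= subnn expr0 mul1r big1 ?addr0.
  have [_ dj] := dP j; rewrite !mulf_neq0 ?dj // ?expf_neq0 // oppr_eq0 oner_neq0 //.
move=> i /andP[ci ij]; rewrite expr0n subn_eq0 leqNgt.
by rewrite ltn_neqAle jmin // andbT (contra_neq _ ij) ?mul0r // => /e_inj.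
Qed.

(** The curve is irreducible: compare leading terms at e2. *)
Lemma eval2_mul_neq0 R1 R2 :
  (exists x u, model x u /\ eval2 R1 x u != 0) ->
  (exists x u, model x u /\ eval2 R2 x u != 0) ->
  exists x u, model x u /\ eval2 R1 x u * eval2 R2 x u != 0.
Proof.
move=> /eval2_leading_term[k1 [L1 [M1 [S1 [S1n E1]]]]] /eval2_leading_term[k2 [L2 [M2 [S2 [S2n E2]]]]].
apply: contrapT => no; have : eval2 (S1 * S2) 0 (-1) = 0.
  apply: eval2_origin => x u m; rewrite /eval2 !hornerM -!/(eval2 _ _ _).
  have x0 := model_neq0 m; have : eval2 R1 x u * eval2 R2 x u = 0.
    by apply/eqP/contraT => z; case: no; exists x, u.
  move=> z; apply: (mulfI (expf_neq0 (k1 + k2) x0)); rewrite mulr0 exprD mulrACA -E1 // -E2 //.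
  by rewrite mulrACA [X in _ * X]mulrACA z !mulr0.
by rewrite /eval2 !hornerM => /eqP; rewrite mulf_eq0 (negPf S1n) (negPf S2n).
Qed.

(** * Points of the curve *)

Notation F := (pellikaan K q).
Notation pt := (curve F).
Notation aut := (curve_aut F).

Definition proj_coords (P : pt) (a b c : K) : Prop :=
  exists2 m, m != 0 & ccoords P = m *: row3 a b c.

Definition c0 (P : pt) := ccoords P 0 (inord 0).
Definition c1 (P : pt) := ccoords P 0 (inord 1).
Definition c2 (P : pt) := ccoords P 0 (inord 2).

Lemma proj_coords_self P : proj_coords P (c0 P) (c1 P) (c2 P).
Proof. by exists 1; rewrite ?oner_eq0 // scale1r; apply: row3E. Qed.

Lemma row3_0 a b c : (@row3 K a b c) 0 (inord 0) = a.
Proof. by rewrite mxE inordK. Qed.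
Lemma row3_1 a b c : (@row3 K a b c) 0 (inord 1) = b.
Proof. by rewrite mxE inordK. Qed.
Lemma row3_2 a b c : (@row3 K a b c) 0 (inord 2) = c.
Proof. by rewrite mxE inordK. Qed.

Lemma proj_coordsE P a b c : proj_coords P a b c ->
  exists2 m, m != 0 & [/\ c0 P = m * a, c1 P = m * b & c2 P = m * c].
Proof.
case=> m m0 e; exists m => //; rewrite /c0 /c1 /c2 e.
by split; rewrite mxE ?row3_0 ?row3_1 ?row3_2.
Qed.

Lemma on_curve P : c0 P * c1 P ^+ q.+1 + c0 P ^+ q.+1 * c2 P + c1 P * c2 P ^+ q.+1 = 0.
Proof.
have /eqP := valP P; rewrite -/(ccoords P) [ccoords P]row3E.
by rewrite feval_pellikaan.
Qed.

Lemma coords_not0 P : [|| c0 P != 0, c1 P != 0 | c2 P != 0].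
Proof.
apply: contraT; rewrite !negb_or !negbK => /and3P[/eqP z0 /eqP z1 /eqP z2].
have := coords_neq0 (val P); rewrite -/(ccoords P) [ccoords P]row3E.
rewrite -/(c0 P) -/(c1 P) -/(c2 P) z0 z1 z2.
case/eqP; apply/rowP=> i; rewrite !mxE; by case: i => [[|[|[|]]]].
Qed.

Lemma point_of_coords a b c :
  a * b ^+ q.+1 + a ^+ q.+1 * c + b * c ^+ q.+1 = 0 ->
  [|| a != 0, b != 0 | c != 0] -> exists P, proj_coords P a b c.
Proof.
move=> e nz; have v0 : row3 a b c != 0.
  apply: contraTneq nz => v0; rewrite !negb_or !negbK.
  have z i : (row3 a b c) 0 i = 0 by rewrite v0 mxE.
  have := (z (inord 0), z (inord 1), z (inord 2)).
  by rewrite row3_0 row3_1 row3_2 => -[[-> ->] ->]; rewrite eqxx.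
have := coordsE (point v0); move=> /esym /vline_eq /(_ (coords_neq0 _))[m m0 mE].
have Q0 : feval F (coords (point v0)) == 0.
  by rewrite mE (feval_scale _ _ (pellikaan_homog K q)) feval_pellikaan e mulr0.
by exists (exist _ (point v0) Q0); exists m.
Qed.

Lemma proj_coords_inj P Q a b c : proj_coords P a b c -> proj_coords Q a b c -> P = Q.
Proof.
case=> m m0 mP [k k0 kQ]; apply: curveP.
by rewrite !coordsE -!/(ccoords _) mP kQ !vline_scale.
Qed.

Lemma proj_coords_scale P a b c k : k != 0 -> proj_coords P (k * a) (k * b) (k * c) -> proj_coords P a b c.
Proof.
move=> k0 [m m0 e]; exists (m * k); rewrite ?mulf_neq0 // e.
apply/rowP=> i; rewrite !mxE -mulrA; congr (_ * _); by case: i => [[|[|[|]]]].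
Qed.

Fact e0_ex : exists P, proj_coords P 1 0 0.
Proof. by apply: point_of_coords; rewrite ?oner_eq0 // !exprS; ring. Qed.
Fact e1_ex : exists P, proj_coords P 0 1 0.
Proof. by apply: point_of_coords; rewrite ?oner_eq0 ?orbT // !exprS; ring. Qed.
Fact e2_ex : exists P, proj_coords P 0 0 1.
Proof. by apply: point_of_coords; rewrite ?oner_eq0 ?orbT // !exprS; ring. Qed.
Definition e0 := projT1 (cid e0_ex).
Definition e1 := projT1 (cid e1_ex).
Definition e2 := projT1 (cid e2_ex).
Lemma e0P : proj_coords e0 1 0 0. Proof. exact: projT2 (cid e0_ex). Qed.
Lemma e1P : proj_coords e1 0 1 0. Proof. exact: projT2 (cid e1_ex). Qed.
Lemma e2P : proj_coords e2 0 0 1. Proof. exact: projT2 (cid e2_ex). Qed.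

Definition inner (P : pt) := [&& c0 P != 0, c1 P != 0 & c2 P != 0].

Lemma pt_cases P : [\/ P = e0, P = e1, P = e2 | inner P].
Proof.
have e := on_curve P; have nz := coords_not0 P; have aP := proj_coords_self P.
have mk a b c k : proj_coords P (k * a) (k * b) (k * c) -> k != 0 -> forall Q, proj_coords Q a b c -> P = Q.
  by move=> h k0 Q; apply: proj_coords_inj; apply: proj_coords_scale h.
move: e nz aP; rewrite /inner; set a := c0 P; set b := c1 P; set c := c2 P.
have [->|a0] := eqVneq a 0.
  rewrite mul0r expr0n mul0r !add0r /= => /eqP; rewrite mulf_eq0 expf_eq0 /=.
  have [-> _ c0 h|b0 /eqP -> _ h] := eqVneq b 0.
    by apply: Or43; apply: mk c0 _ e2P; rewrite !mulr0 mulr1.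
  by apply: Or42; apply: mk b0 _ e1P; rewrite !mulr0 mulr1.
have [->|b0] := eqVneq b 0.
  rewrite expr0n mulr0 mul0r add0r addr0 => /eqP; rewrite mulf_eq0 expf_eq0 /= (negPf a0) /=.
  by move=> /eqP -> _ h; apply: Or41; apply: mk a0 _ e0P; rewrite !mulr0 mulr1.
have [->|c0] := eqVneq c 0; last by move=> *; apply: Or44.
rewrite expr0n !mulr0 !addr0 => /eqP.
by rewrite mulf_eq0 expf_eq0 /= (negPf a0) (negPf b0).
Qed.

Definition xf P := c0 P / c2 P.
Definition yf P := c1 P / c2 P.
Definition uf P := xf P ^+ q.+1 / yf P.

Lemma inner_xy P : inner P -> xf P != 0 /\ yf P != 0.
Proof. by case/and3P => a0 b0 c0'; rewrite !mulf_neq0 ?invr_eq0. Qed.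

Lemma affine_rel P : c2 P != 0 -> xf P * yf P ^+ q.+1 + xf P ^+ q.+1 + yf P = 0.
Proof.
move=> z; have := on_curve P.
rewrite -[c0 P](divfK z) -[c1 P](divfK z) -/(xf P) -/(yf P) => e.
apply: (mulIf (expf_neq0 q.+2 z)); rewrite mul0r -e !exprMn !(exprS (c2 P)).
by ring.
Qed.

Lemma inner_uE P : inner P -> 1 + uf P = - (xf P * yf P ^+ q).
Proof.
move=> iP; have [x0 y0] := inner_xy iP; have /and3P[_ _ z] := iP.
have := affine_rel z; rewrite /uf exprSr => /eqP; rewrite -addrA addr_eq0 => /eqP e.
apply: (mulIf y0); rewrite mulrDl divfK // mul1r mulNr -mulrA e opprK.
by rewrite addrC.
Qed.

Lemma inner_model P : inner P -> model (xf P) (uf P).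
Proof.
move=> iP; have [x0 y0] := inner_xy iP; have uE := inner_uE iP.
split.
- by rewrite mulf_neq0 ?invr_eq0 ?expf_neq0.
- by rewrite -subr_eq0 opprK addrC uE oppr_eq0 mulf_neq0 ?expf_neq0.
rewrite branchE uE /uf.
have -> : N = (q.+1 * q + 1)%N by rewrite /N; nia.
rewrite exprD exprM expr1 [(_ / yf P) ^+ _]expr_div_n mulrN mulNr opprK.
rewrite [RHS]mulrCA divfK ?expf_neq0 //.
by rewrite mulrC.
Qed.

Lemma model_inner x u : model x u ->
  exists P, [/\ inner P, proj_coords P x (x ^+ q.+1 / u) 1, xf P = x & uf P = u].
Proof.
move=> m; have [u0 u1 e] := m; have x0 := model_neq0 m.
have [||P aP] := @point_of_coords x (x ^+ q.+1 / u) 1; last first.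
- have [k k0 [E0 E1 E2]] := proj_coordsE aP.
  have xE : xf P = x by rewrite /xf E0 E2 mulr1 mulrC mulKf.
  exists P; split=> //.
    by rewrite /inner E0 E1 E2 !mulf_neq0 ?invr_eq0 ?oner_eq0 ?expf_neq0.
  rewrite /uf xE /yf E1 E2; field; by rewrite k0 u0 !expf_neq0.
- by rewrite oner_eq0 !orbT.
move: e; rewrite branchE.
have -> : N = (q.+1 * q + 1)%N by rewrite /N; nia.
rewrite exprD exprM expr1 !expr1n !mulr1 => e.
have uq : u ^+ q != 0 by rewrite expf_neq0.
rewrite [(_ / u) ^+ q.+1]exprSr expr_div_n.
transitivity (x ^+ q.+1 / u * ((x ^+ q.+1) ^+ q * x / u ^+ q + u + 1)).
  by field; rewrite u0 uq.
by rewrite e; field; rewrite u0 uq.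
Qed.

Lemma inner_ex : exists P, inner P.
Proof.
have [u [u0 u1]] : exists u : K, u != 0 /\ u != -1.
  apply: contrapT => no; have /eqP := oner_neq0 {poly K}; case.
  by apply: poly_eq0_unramified => u u0 u1; case: no; exists u.
have [x m] := model_ex u0 u1.
by have [P []] := model_inner m; exists P.
Qed.

(** A form h as a polynomial in x and u, by the parametrisation
    (x u : x^(q+1) : u) of the points off the triangle. *)
Definition form_poly (h : {mpoly K[3]}) : {poly {poly K}} :=
  mmap (polyC \o polyC)
    (fun i : 'I_3 => ([:: 'X * ('X)%:P; 'X^(q.+1); ('X)%:P] : seq {poly {poly K}})`_i) h.

Lemma eval2_form_poly h x u : eval2 (form_poly h) x u = feval h (row3 (x * u) (x ^+ q.+1) u).
Proof.
rewrite /feval mevalE /form_poly /mmap /eval2.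
rewrite !horner_sum; apply: eq_bigr => m _.
rewrite /= !hornerM !hornerC; congr (_ * _).
rewrite /mmap1 !horner_prod; apply: eq_bigr => i _.
rewrite !horner_exp mxE; congr (_ ^+ _).
case: i => [[|[|[|]]]] //= _;
  by rewrite ?hornerM ?hornerX ?hornerC ?hornerXn -?polyC_exp ?hornerX ?hornerC.
Qed.

Lemma inner_coords_xy P : inner P -> proj_coords P (xf P) (yf P) 1.
Proof.
case/and3P => a0 b0 cc; apply: (proj_coords_scale cc).
rewrite /xf /yf mulr1 ![c2 P * _]mulrC !divfK //; exact: proj_coords_self.
Qed.

Lemma inner_coords_u P : inner P -> proj_coords P (xf P * uf P) (xf P ^+ q.+1) (uf P).
Proof.
move=> iP; have [x0 y0] := inner_xy iP; have [u0 _ _] := inner_model iP.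
have ui : (uf P)^-1 != 0 by rewrite invr_eq0.
apply: (proj_coords_scale ui).
have -> : (uf P)^-1 * (xf P * uf P) = xf P by rewrite mulrC mulfK.
have -> : (uf P)^-1 * xf P ^+ q.+1 = yf P by rewrite /uf; field; rewrite y0 expf_neq0.
by rewrite mulVf //; apply: inner_coords_xy.
Qed.

Lemma feval_proj_coords n h P a b c : h \is n.-homog -> proj_coords P a b c ->
  exists2 m, m != 0 & feval h (ccoords P) = m * feval h (row3 a b c).
Proof.
move=> hh [m m0 ->]; exists (m ^+ n); rewrite ?expf_neq0 //.
by rewrite (feval_scale _ _ hh).
Qed.

Lemma feval_inner n h P : h \is n.-homog -> inner P ->
  exists2 m, m != 0 & feval h (ccoords P) = m * eval2 (form_poly h) (xf P) (uf P).
Proof. by move=> hh iP; rewrite eval2_form_poly; apply: feval_proj_coords hh _; apply: inner_coords_u. Qed.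

(** * Generic properties and values of rational functions *)

Notation sg := (sigma lam_prim).
Notation tu := (tau K q).

Lemma lin_aut_coords d (hd : F \is d.-homog) M (uM : M \in unitmx) (pM : preserves F M) (P : pt) v :
  (exists2 m, m != 0 & ccoords P = m *: v) ->
  exists2 m, m != 0 & ccoords (lin_aut hd uM pM P) = m *: (v *m M).
Proof.
case=> m m0 e.
have E : (<[ccoords (lin_aut hd uM pM P)]> = <[ccoords P *m M]>)%VS.
  by rewrite [LHS](esym (coordsE _)).
have [k k0 kE] := vline_eq E (coords_neq0 _).
by exists (k * m); rewrite ?mulf_neq0 // kE e -scalemxAl scalerA.
Qed.

Lemma tau_coords P a b c : proj_coords P a b c -> proj_coords (tu P) c a b.
Proof. by move=> h; rewrite /proj_coords -tau_mxE; apply: lin_aut_coords. Qed.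

Lemma sigma_coords P a b c : proj_coords P a b c -> proj_coords (sg P) a (lam * b) (lam ^+ q.+1 * c).
Proof. by move=> h; rewrite /proj_coords -sigma_mxE; apply: lin_aut_coords. Qed.

Lemma tau_e0 : tu e0 = e1.
Proof. exact: proj_coords_inj (tau_coords e0P) e1P. Qed.
Lemma tau_e1 : tu e1 = e2.
Proof. exact: proj_coords_inj (tau_coords e1P) e2P. Qed.
Lemma tau_e2 : tu e2 = e0.
Proof. exact: proj_coords_inj (tau_coords e2P) e0P. Qed.

Lemma inner_tau P : inner P -> inner (tu P).
Proof.
case/and3P=> a b c; have [m m0 [E0 E1 E2]] := proj_coordsE (tau_coords (proj_coords_self P)).
by rewrite /inner E0 E1 E2 !mulf_neq0.
Qed.

Lemma aut_local_forms (phi : aut) (P : pt) : exists d (A : 'I_3 -> {mpoly K[3]}) e h,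
  [/\ forall i, A i \is d.-homog, h \is e.-homog, feval h (ccoords P) != 0 &
    forall Q : pt, feval h (ccoords Q) != 0 ->
      exists2 m, m != 0 & ccoords (phi Q) = m *: feval3 A (ccoords Q)].
Proof.
have [d [e [A [h [hA hh hP AE]]]]] := aut_regular phi P.
exists d, A, e, h; split=> // Q hQ.
by apply: vline_eq (coords_neq0 _); rewrite -coordsE AE.
Qed.

Definition nonzero (h : {mpoly K[3]}) := exists P : pt, feval h (ccoords P) != 0.

Lemma form_pullback (phi : aut) (P : pt) n h : h \is n.-homog -> feval h (ccoords (phi P)) != 0 ->
  exists n' h', [/\ h' \is n'.-homog, feval h' (ccoords P) != 0 &
    forall Q : pt, feval h' (ccoords Q) != 0 -> feval h (ccoords (phi Q)) != 0].
Proof.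
move=> hn hP; have [d [A [e [g [hA hg gP AE]]]]] := aut_local_forms phi P.
have EE Q : feval g (ccoords Q) != 0 -> exists2 k, k != 0 &
   feval h (ccoords (phi Q)) = k * feval (fcomp3 h A) (ccoords Q).
  move=> gQ; have [m m0 mE] := AE Q gQ; exists (m ^+ n); rewrite ?expf_neq0 //.
  by rewrite mE (feval_scale _ _ hn) feval_comp.
exists (e + d * n)%N, (g * fcomp3 h A); split.
- by apply: dhomogM => //; apply: fcomp3_homog.
- rewrite /feval mevalM mulf_neq0 //; have [k k0 kE] := EE P gP.
  by move: hP; rewrite kE mulf_eq0 negb_or => /andP[].
move=> Q; rewrite /feval mevalM mulf_eq0 negb_or => /andP[gQ fQ].
by have [k k0 kE] := EE Q gQ; rewrite -/(feval _ _) kE mulf_neq0.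
Qed.

(** A form that does not vanish at a vertex cannot vanish on all the other
    points: at e2 this is [eval2_origin], and tau carries e2 to e0 and e1. *)
Lemma nonzero_inner n h : h \is n.-homog -> nonzero h ->
  exists P : pt, inner P /\ feval h (ccoords P) != 0.
Proof.
have base k g : g \is k.-homog -> feval g (ccoords e2) != 0 ->
    exists P : pt, inner P /\ feval g (ccoords P) != 0.
  move=> hg gn; apply: contrapT => no.
  have z : eval2 (form_poly g) 0 (-1) = 0.
    apply: eval2_origin => x u m.
    have [P [iP aP <- <-]] := model_inner m.
    have [k' k0 kE] := feval_inner hg iP; apply/eqP/contraT => nz; case: no; exists P.
    by rewrite kE mulf_neq0.
  case/negP: gn; have [k' k0 ->] := feval_proj_coords hg e2P.
  move: z; rewrite eval2_form_poly mul0r expr0n /= => z.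
  have := feval_scale (-1) (row3 0 0 (-1)) hg.
  have -> : -1 *: row3 0 0 (-1) = @row3 K 0 0 1.
    by apply/rowP=> i; rewrite !mxE; case: i => [[|[|[|]]]] //= _; rewrite mulN1r ?oppr0 ?opprK.
  by rewrite z !mulr0 => ->; rewrite mulr0.
have push k g P : g \is k.-homog -> feval g (ccoords (tu P)) != 0 ->
    (forall n' g', g' \is n'.-homog -> feval g' (ccoords P) != 0 ->
       exists P : pt, inner P /\ feval g' (ccoords P) != 0) ->
    exists P : pt, inner P /\ feval g (ccoords P) != 0.
  move=> hg gP IH; have [n' [g' [hg' gP' E]]] := form_pullback hg gP.
  have [Q [iQ gQ]] := IH _ _ hg' gP'; exists (tu Q); split; first exact: inner_tau.
  exact: E.
have base0 k g : g \is k.-homog -> feval g (ccoords e0) != 0 ->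
    exists P : pt, inner P /\ feval g (ccoords P) != 0.
  by rewrite -tau_e2 => hg gn; apply: push hg gn base.
move=> hn [P hP]; have [E|E|E|iP] := pt_cases P; last by exists P.
- by apply: (base0 n); rewrite -?E.
- by apply: push hn _ base0; rewrite tau_e0 -E.
by apply: (base n); rewrite -?E.
Qed.

Lemma nonzero_mul n h n' h' : h \is n.-homog -> h' \is n'.-homog ->
  nonzero h -> nonzero h' -> nonzero (h * h').
Proof.
have toev k g : g \is k.-homog -> nonzero g ->
   exists x u, model x u /\ eval2 (form_poly g) x u != 0.
  move=> hg /(nonzero_inner hg)[P [iP gP]].
  have [m m0 mE] := feval_inner hg iP.
  exists (xf P), (uf P); split; first exact: inner_model.
  by move: gP; rewrite mE mulf_eq0 negb_or => /andP[].
move=> hh hh' z z'.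
have [x [u [m nz]]] := eval2_mul_neq0 (toev _ _ hh z) (toev _ _ hh' z').
have [P [iP _ xE uE]] := model_inner m; exists P.
have [k k0 kE] := feval_inner hh iP; have [k' k0' kE'] := feval_inner hh' iP.
rewrite /feval mevalM -!/(feval _ _) kE kE' xE uE mulrACA.
by apply: mulf_neq0 => //; apply: mulf_neq0.
Qed.

(** Truth on a nonempty open subset.  By irreducibility this is stable under
    conjunction, and rational functions are functions up to generic equality. *)
Definition generic (A : pt -> Prop) : Prop := exists n h,
  [/\ h \is n.-homog, nonzero h & forall Q, feval h (ccoords Q) != 0 -> A Q].

Lemma generic_mono (A B : pt -> Prop) : generic A -> (forall Q, A Q -> B Q) -> generic B.
Proof. by case=> n [h [hn hz hA]] AB; exists n, h; split=> // Q /hA/AB. Qed.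

Lemma generic_and A B : generic A -> generic B -> generic (fun Q => A Q /\ B Q).
Proof.
case=> n [h [hn hz hA]] [n' [h' [hn' hz' hB]]].
exists (n + n')%N, (h * h'); split; first exact: dhomogM.
  exact: nonzero_mul hn hn' hz hz'.
move=> Q; rewrite /feval mevalM mulf_eq0 negb_or => /andP[? ?].
by split; [apply: hA | apply: hB].
Qed.

Lemma generic_mono2 (A B C : pt -> Prop) :
  generic A -> generic B -> (forall Q, A Q -> B Q -> C Q) -> generic C.
Proof. by move=> gA gB h; apply: generic_mono (generic_and gA gB) _ => Q [? ?]; apply: h. Qed.

Lemma generic_ex A : generic A -> exists Q, A Q.
Proof. by case=> n [h [hn [P hP] hA]]; exists P; apply: hA. Qed.

Lemma coord_homog i : ('X_i : {mpoly K[3]}) \is 1.-homog.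
Proof. by rewrite dhomogX /= mdeg1. Qed.

Lemma generic_inner : generic (fun Q => inner Q).
Proof.
have hX := coord_homog.
exists (1 + 1 + 1)%N, (X0 K * X1 K * X2 K); split.
- by rewrite !dhomogM ?hX.
- have [P iP] := inner_ex; exists P; case/and3P: iP => a b c.
  by rewrite /feval !mevalM !mevalXU !mulf_neq0.
move=> Q; rewrite /feval !mevalM !mevalXU !mulf_eq0 !negb_or -andbA.
by [].
Qed.

Lemma generic_true (A : pt -> Prop) : (forall Q, A Q) -> generic A.
Proof. by move=> h; apply: generic_mono generic_inner _. Qed.

Lemma generic_aut (phi : aut) A : generic A -> generic (fun Q => A (phi Q)).
Proof.
case=> n [h [hn [P hP] hA]].
have hP' : feval h (ccoords (phi (aut_inv phi P))) != 0 by rewrite aut_invK.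
have [n' [h' [hn' hP'' E]]] := form_pullback hn hP'.
by exists n', h'; split=> //; [exists (aut_inv phi P) | move=> Q /E/hA].
Qed.

(** [f] is generically a quotient of forms that is regular at [P] and has value
    [c] there.  This sees [f] only up to generic equality, so that a function
    written with divisions by zero has a value wherever it extends. *)
Definition value (P : pt) (c : K) (f : pt -> K) : Prop := exists n a b,
  [/\ a \is n.-homog, b \is n.-homog, feval b (ccoords P) != 0,
      feval a (ccoords P) = c * feval b (ccoords P) &
      generic (fun Q => f Q * feval b (ccoords Q) = feval a (ccoords Q))].

Lemma value_generic P c f g : value P c f -> generic (fun Q => f Q = g Q) -> value P c g.
Proof.
case=> n [a [b [ha hb b0 e G]]] E; exists n, a, b; split=> //.
by apply: generic_mono2 E G _ => Q ->.
Qed.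

Lemma value_cast P c c' f : value P c f -> c = c' -> value P c' f.
Proof. by move=> h <-. Qed.

Lemma fevalM a b v : feval (a * b) v = feval a v * feval b v :> K.
Proof. exact: mevalM. Qed.
Lemma fevalD a b v : feval (a + b) v = feval a v + feval b v :> K.
Proof. exact: mevalD. Qed.

Lemma value_add P c d f g : value P c f -> value P d g -> value P (c + d) (fun Q => f Q + g Q).
Proof.
case=> n [a [b [ha hb b0 e G]]] [n' [a' [b' [ha' hb' b0' e' G']]]].
exists (n + n')%N, (a * b' + a' * b), (b * b'); split.
- by apply: rpredD; [|rewrite addnC]; apply: dhomogM.
- exact: dhomogM.
- by rewrite fevalM mulf_neq0.
- by rewrite fevalD !fevalM e e'; ring.
by apply: generic_mono2 G G' _ => Q E E'; rewrite fevalD !fevalM -E -E'; ring.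
Qed.

Lemma value_mul P c d f g : value P c f -> value P d g -> value P (c * d) (fun Q => f Q * g Q).
Proof.
case=> n [a [b [ha hb b0 e G]]] [n' [a' [b' [ha' hb' b0' e' G']]]].
exists (n + n')%N, (a * a'), (b * b'); split.
- exact: dhomogM.
- exact: dhomogM.
- by rewrite fevalM mulf_neq0.
- by rewrite !fevalM e e'; ring.
by apply: generic_mono2 G G' _ => Q E E'; rewrite !fevalM -E -E'; ring.
Qed.

Lemma value_cst P c : value P c (fun=> c).
Proof.
have h1 (k : K) : (k%:MP : {mpoly K[3]}) \is 0.-homog.
  by rewrite -[k%:MP]mulr1 mul_mpolyC rpredZ // dhomog1.
exists 0%N, c%:MP, 1; split=> //; rewrite /feval ?mevalC ?meval1 ?mulr1 ?oner_eq0 ?dhomog1 //.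
by apply: generic_true => Q; rewrite mevalC meval1 mulr1.
Qed.

Lemma value_neq0_generic P c f : value P c f -> c != 0 -> generic (fun Q => f Q != 0).
Proof.
case=> n [a [b [ha hb b0 e G]]] c0.
have Ga : generic (fun Q => feval a (ccoords Q) != 0).
  by exists n, a; split=> //; exists P; rewrite e mulf_neq0.
apply: generic_mono2 G Ga _ => Q <-; rewrite mulf_eq0 negb_or => /andP[]; by [].
Qed.

Lemma value_inv P c f : value P c f -> c != 0 -> value P c^-1 (fun Q => (f Q)^-1).
Proof.
move=> V c0; have fn := value_neq0_generic V c0.
case: V => n [a [b [ha hb b0 e G]]].
exists n, b, a; split=> //; first by rewrite e mulf_neq0.
  by rewrite e mulKf.
by apply: generic_mono2 G fn _ => Q <- z; rewrite mulKf.
Qed.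

Lemma value_div P c d f g : value P c f -> value P d g -> d != 0 ->
  value P (c / d) (fun Q => f Q / g Q).
Proof. by move=> Vf Vg d0; apply: value_mul => //; apply: value_inv. Qed.

Lemma value_opp P c f : value P c f -> value P (- c) (fun Q => - f Q).
Proof.
move=> V; rewrite -mulN1r; apply: value_generic (value_mul (value_cst P (-1)) V) _.
by apply: generic_true => Q; rewrite mulN1r.
Qed.

Lemma value_sub P c d f g : value P c f -> value P d g -> value P (c - d) (fun Q => f Q - g Q).
Proof. by move=> Vf Vg; apply: value_add => //; apply: value_opp. Qed.

Lemma value_exp P c f n : value P c f -> value P (c ^+ n) (fun Q => f Q ^+ n).
Proof.
move=> V; elim: n => [|n IH]; first by rewrite expr0; apply: value_cst.
by rewrite exprS; apply: value_generic (value_mul V IH) _; apply: generic_true => Q; rewrite exprS.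
Qed.

Lemma value_sum P n (c : nat -> K) (f : nat -> pt -> K) :
  (forall i, (i < n)%N -> value P (c i) (f i)) ->
  value P (\sum_(i < n) c i) (fun Q => \sum_(i < n) f i Q).
Proof.
elim: n => [|n IH] h.
  by rewrite big_ord0; apply: value_generic (value_cst P 0) _; apply: generic_true => Q; rewrite big_ord0.
rewrite big_ord_recr; have V := value_add (IH (fun i l => h i (ltnW l))) (h n (ltnSn n)).
by apply: value_generic V _; apply: generic_true => Q; rewrite big_ord_recr.
Qed.

Lemma value_uniq P c d f : value P c f -> value P d f -> c = d.
Proof.
move=> V V'; apply/eqP; rewrite -subr_eq0; apply/contraT => nz.
have := value_neq0_generic (value_sub V V') nz => /generic_ex[Q].
by rewrite subrr eqxx.
Qed.

Lemma value_aut (phi : aut) P c f : value (phi P) c f -> value P c (fun Q => f (phi Q)).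
Proof.
case=> n [a [b [ha hb b0 e G]]].
have [d [A [k [h [hA hh hP AE]]]]] := aut_local_forms phi P.
have EE Q : feval h (ccoords Q) != 0 -> exists2 m, m != 0 &
    forall g, g \is n.-homog -> feval g (ccoords (phi Q)) = m * feval (fcomp3 g A) (ccoords Q).
  move=> hQ; have [m m0 mE] := AE Q hQ; exists (m ^+ n); rewrite ?expf_neq0 // => g hg.
  by rewrite mE (feval_scale _ _ hg) feval_comp.
have [m m0 mE] := EE P hP.
exists (d * n)%N, (fcomp3 a A), (fcomp3 b A); split.
- exact: fcomp3_homog.
- exact: fcomp3_homog.
- by move: b0; rewrite mE // mulf_eq0 negb_or => /andP[].
- by move: e; rewrite !mE // mulrCA => /(mulfI m0).
have Gh : generic (fun Q => feval h (ccoords Q) != 0) by exists k, h; split=> //; exists P.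
apply: generic_mono2 (generic_aut phi G) Gh _ => Q E hQ.
by have [m' m0' mE'] := EE Q hQ; move: E; rewrite !mE' // mulrCA => /(mulfI m0').
Qed.

Lemma value_ratio (P : pt) (i j : 'I_3) : ccoords P 0 j != 0 ->
  value P (ccoords P 0 i / ccoords P 0 j) (fun Q => ccoords Q 0 i / ccoords Q 0 j).
Proof.
move=> cj; exists 1%N, 'X_i, 'X_j; split; rewrite ?coord_homog //.
- by rewrite /feval mevalXU.
- by rewrite /feval !mevalXU divfK.
exists 1%N, 'X_j; split; rewrite ?coord_homog //.
  by exists P; rewrite /feval mevalXU.
by move=> Q; rewrite /feval !mevalXU => z; rewrite divfK.
Qed.

(** * The functions x, y, u and their values at the vertices *)

Lemma xf_yf_coords P a b c : proj_coords P a b c -> xf P = a / c /\ yf P = b / c.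
Proof.
move=> /proj_coordsE[m m0 [E0 E1 E2]]; rewrite /xf /yf E0 E1 E2 -!mulf_div.
by rewrite divff // !mul1r.
Qed.

Lemma zetaE : zeta * lam ^+ q.+1 = 1.
Proof. by rewrite /zeta -exprD -(prim_expr_order lam_prim); congr (_ ^+ _); rewrite /N; lia. Qed.

Lemma xf_sigma P : xf (sg P) = zeta * xf P.
Proof.
have [-> _] := xf_yf_coords (sigma_coords (proj_coords_self P)).
have l0 : lam ^+ q.+1 != 0 by rewrite expf_neq0 // (lam_neq0 lam_prim).
rewrite invfM mulrCA -/(xf P); congr (_ * _).
by apply: (mulIf l0); rewrite mulVf // zetaE.
Qed.

Lemma yf_sigma P : yf (sg P) = zeta * lam * yf P.
Proof.
have [_ ->] := xf_yf_coords (sigma_coords (proj_coords_self P)).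
have l0 : lam ^+ q.+1 != 0 by rewrite expf_neq0 // (lam_neq0 lam_prim).
have -> : zeta = (lam ^+ q.+1)^-1 by apply: (mulIf l0); rewrite mulVf // zetaE.
by rewrite invfM /yf; ring.
Qed.

Lemma uf_sigma P : uf (sg P) = uf P.
Proof.
rewrite /uf xf_sigma yf_sigma exprMn.
have l0 := lam_neq0 lam_prim; have z0 : zeta != 0 by rewrite expf_neq0.
have e : zeta ^+ q.+1 = zeta * lam.
  rewrite /zeta -exprM -exprSr -[RHS]mul1r -(expr1n _ q.-1) -(prim_expr_order lam_prim).
  rewrite -exprM -exprD; congr (_ ^+ _); rewrite /N.
  by case: (q) q_gt2 => // k _; rewrite -pred_Sn; nia.
by rewrite e -mulf_div divff ?mul1r // mulf_neq0.
Qed.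

Notation sigma_it s := ((sg ^+ s)%g : aut).

Lemma sigma_itS s P : sigma_it s.+1 P = sg (sigma_it s P).
Proof. by rewrite expgS. Qed.

Lemma xf_sigma_it s P : xf (sigma_it s P) = zeta ^+ s * xf P.
Proof.
elim: s => [|s IH]; first by rewrite mul1r.
by rewrite sigma_itS xf_sigma IH exprS mulrA.
Qed.

Lemma uf_sigma_it s P : uf (sigma_it s P) = uf P.
Proof. by elim: s => [|s IH] //; rewrite sigma_itS uf_sigma. Qed.

Lemma inner_sigma P : inner P -> inner (sg P).
Proof.
case/and3P=> a b c; have [m m0 [E0 E1 E2]] := proj_coordsE (sigma_coords (proj_coords_self P)).
by rewrite /inner E0 E1 E2 !mulf_neq0 ?expf_neq0 ?(lam_neq0 lam_prim).
Qed.

Lemma inner_sigma_it s P : inner P -> inner (sigma_it s P).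
Proof. by move=> iP; elim: s => [|s IH] //; rewrite sigma_itS inner_sigma. Qed.

Lemma sigma_e0 : sg e0 = e0.
Proof. by apply: proj_coords_inj (sigma_coords e0P) _; rewrite !mulr0; apply: e0P. Qed.
Lemma sigma_e1 : sg e1 = e1.
Proof.
apply: proj_coords_inj (sigma_coords e1P) _; have l0 := lam_neq0 lam_prim.
by apply: (@proj_coords_scale _ _ _ _ lam^-1); rewrite ?invr_eq0 // !mulr0 mulr1 mulVf //; apply: e1P.
Qed.
Lemma sigma_e2 : sg e2 = e2.
Proof.
apply: proj_coords_inj (sigma_coords e2P) _; have l0 := expf_neq0 q.+1 (lam_neq0 lam_prim).
by apply: (@proj_coords_scale _ _ _ _ (lam ^+ q.+1)^-1); rewrite ?invr_eq0 // !mulr0 mulr1 mulVf //; apply: e2P.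
Qed.
Lemma sigma_it_e0 s : sigma_it s e0 = e0.
Proof. by elim: s => [|s IH] //; rewrite sigma_itS IH sigma_e0. Qed.
Lemma sigma_it_e1 s : sigma_it s e1 = e1.
Proof. by elim: s => [|s IH] //; rewrite sigma_itS IH sigma_e1. Qed.
Lemma sigma_it_e2 s : sigma_it s e2 = e2.
Proof. by elim: s => [|s IH] //; rewrite sigma_itS IH sigma_e2. Qed.

Lemma inner_neq P : inner P -> [/\ P <> e0, P <> e1 & P <> e2].
Proof.
case/and3P=> a b c; split=> E.
- by have [m m0 [_ E1 _]] := proj_coordsE e0P; move: b; rewrite E E1 mulr0 eqxx.
- by have [m m0 [E0 _ _]] := proj_coordsE e1P; move: a; rewrite E E0 mulr0 eqxx.
by have [m m0 [E0 _ _]] := proj_coordsE e2P; move: a; rewrite E E0 mulr0 eqxx.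
Qed.

Lemma value_eq (P : pt) c d f g : value P d g -> generic (fun Q => f Q = g Q) -> d = c -> value P c f.
Proof. by move=> V G <-; apply: value_generic V _; apply: generic_mono G _. Qed.

Lemma value_eq_inner (P : pt) c d f g : value P d g -> (forall Q, inner Q -> f Q = g Q) -> d = c -> value P c f.
Proof. by move=> V G; apply: value_eq V _; apply: generic_mono generic_inner G. Qed.

Lemma value_x_inner P : inner P -> value P (xf P) xf.
Proof. by case/and3P=> _ _ c; apply: value_ratio. Qed.
Lemma value_y_inner P : inner P -> value P (yf P) yf.
Proof. by case/and3P=> _ _ c; apply: value_ratio. Qed.
Lemma value_u_inner P : inner P -> value P (uf P) uf.
Proof.
move=> iP; have [_ y0] := inner_xy iP.
by apply: value_div y0; [apply/value_exp/value_x_inner | apply: value_y_inner].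
Qed.

Lemma inner_rel Q : inner Q -> xf Q * yf Q ^+ q.+1 + xf Q ^+ q.+1 + yf Q = 0.
Proof. by case/and3P=> _ _ c; apply: affine_rel. Qed.

(** With x^q and y^q as separate unknowns A and B, the identities used below
    become multiples of the relation, which [field] can check. *)
Lemma rel_split Q : inner Q -> exists x y A B, [/\ xf Q = x, yf Q = y, x ^+ q = A & y ^+ q = B] /\
  [/\ x != 0, y != 0, A != 0, B != 0 & x * (y * B) + x * A + y = 0].
Proof.
move=> iQ; have [x0 y0] := inner_xy iQ; exists (xf Q), (yf Q), (xf Q ^+ q), (yf Q ^+ q).
by split; split=> //; rewrite ?expf_neq0 // -!exprS (inner_rel iQ).
Qed.

Definition zf P := yf P / xf P.

Lemma value_e0_z : value e0 0 zf.
Proof.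
have [m m0 [E0 E1 E2]] := proj_coordsE e0P.
apply: (@value_eq_inner _ _ _ _ _ (@value_ratio e0 (inord 1) (inord 0) _)).
- by rewrite -/(c0 e0) E0 mulr1.
- move=> Q /and3P[a b c]; rewrite /zf /yf /xf -/(c0 Q) -/(c1 Q).
  by rewrite invf_div mulrA divfK.
by rewrite -/(c1 e0) E1 mulr0 mul0r.
Qed.

Lemma value_e0_xV : value e0 0 (fun Q => (xf Q)^-1).
Proof.
have [m m0 [E0 E1 E2]] := proj_coordsE e0P.
apply: (@value_eq_inner _ _ _ _ _ (@value_ratio e0 (inord 2) (inord 0) _)).
- by rewrite -/(c0 e0) E0 mulr1.
- by move=> Q /and3P[a b c]; rewrite /xf -/(c0 Q) -/(c2 Q) invf_div.
by rewrite -/(c2 e0) E2 mulr0 mul0r.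
Qed.

Lemma value_e0_uV : value e0 0 (fun Q => (uf Q)^-1).
Proof.
apply: (value_eq_inner (value_mul value_e0_z (value_exp q value_e0_xV))); last by rewrite mul0r.
move=> Q iQ; have [x0 y0] := inner_xy iQ.
by rewrite /uf /zf invf_div exprVn exprS invfM !mulrA.
Qed.

(** Since y/x is a local parameter at e0, this says that x has a pole of order
    exactly q+1 there. *)
Lemma value_e0_xz : value e0 (-1) (fun Q => xf Q * zf Q ^+ q.+1).
Proof.
apply: (value_eq_inner (value_opp (value_add (value_cst e0 1) (value_mul value_e0_z (value_exp q value_e0_xV))))).
  move=> Q /rel_split[x [y [A [B [[xE yE AE BE] [x0 y0 A0 B0 e]]]]]].
  rewrite /zf xE yE exprVn expr_div_n !exprS AE BE; apply: subr0_eq.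
  transitivity ((x * (y * B) + x * A + y) / (x * A)); last by rewrite e mul0r.
  by field; rewrite x0 A0.
by rewrite mul0r addr0.
Qed.

Lemma value_e1_yV : value e1 0 (fun Q => (yf Q)^-1).
Proof.
have [m m0 [E0 E1 E2]] := proj_coordsE e1P.
apply: (@value_eq_inner _ _ _ _ _ (@value_ratio e1 (inord 2) (inord 1) _)).
- by rewrite -/(c1 e1) E1 mulr1.
- by move=> Q /and3P[a b c]; rewrite /yf -/(c1 Q) -/(c2 Q) invf_div.
by rewrite -/(c2 e1) E2 mulr0 mul0r.
Qed.

Lemma value_e1_xy : value e1 0 (fun Q => xf Q / yf Q).
Proof.
have [m m0 [E0 E1 E2]] := proj_coordsE e1P.
apply: (@value_eq_inner _ _ _ _ _ (@value_ratio e1 (inord 0) (inord 1) _)).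
- by rewrite -/(c1 e1) E1 mulr1.
- move=> Q /and3P[a b c]; rewrite /yf /xf -/(c0 Q) -/(c1 Q).
  by rewrite invf_div mulrA divfK.
by rewrite -/(c0 e1) E0 mulr0 mul0r.
Qed.

Lemma value_e1_x : value e1 0 xf.
Proof.
apply: (value_eq_inner (value_opp (value_add (value_exp q.+1 value_e1_xy) (value_exp q value_e1_yV)))).
  move=> Q /rel_split[x [y [A [B [[xE yE AE BE] [x0 y0 A0 B0 e]]]]]].
  rewrite xE yE exprVn expr_div_n !exprS AE BE; apply: subr0_eq.
  transitivity ((x * (y * B) + x * A + y) / (y * B)); last by rewrite e mul0r.
  by field; rewrite y0 B0.
by rewrite !expr0n /= gtn_eqF ?addr0 ?oppr0 // (leq_trans _ q_gt2).
Qed.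

Lemma value_e1_u : value e1 0 uf.
Proof.
have VW := value_mul (value_exp q value_e1_xy) value_e1_yV.
have VD : value e1 1 (fun Q => 1 + (xf Q / yf Q) ^+ q * (yf Q)^-1).
  by apply: value_cast (value_add (value_cst _ _) VW) _; rewrite mulr0 addr0.
apply: (value_eq (value_opp (value_div VW VD (oner_neq0 _)))); last by rewrite mulr0 mul0r oppr0.
apply: generic_mono2 generic_inner (value_neq0_generic VD (oner_neq0 _)) _ => Q.
move=> /rel_split[x [y [A [B [[xE yE AE BE] [x0 y0 A0 B0 e]]]]]].
rewrite /uf xE yE expr_div_n !exprS AE BE => D0.
apply: subr0_eq; apply: (mulIf D0); rewrite mul0r opprK mulrDl divfK //.
transitivity ((x * (y * B) + x * A + y) * (A / (B * y * y))); last by rewrite e mul0r.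
by field; rewrite y0 B0.
Qed.

Lemma value_e2_x : value e2 0 xf.
Proof.
have [m m0 [E0 E1 E2]] := proj_coordsE e2P.
apply: value_cast (@value_ratio e2 (inord 0) (inord 2) _) _.
  by rewrite -/(c2 e2) E2 mulr1.
by rewrite -/(c0 e2) E0 mulr0 mul0r.
Qed.

Lemma value_e2_y : value e2 0 yf.
Proof.
have [m m0 [E0 E1 E2]] := proj_coordsE e2P.
apply: value_cast (@value_ratio e2 (inord 1) (inord 2) _) _.
  by rewrite -/(c2 e2) E2 mulr1.
by rewrite -/(c1 e2) E1 mulr0 mul0r.
Qed.

Lemma value_e2_u : value e2 (-1) uf.
Proof.
apply: (value_eq_inner (value_sub (value_cst e2 (-1)) (value_mul value_e2_x (value_exp q value_e2_y)))).
  move=> Q iQ; have := inner_uE iQ => e.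
  by rewrite -(addKr 1 (uf Q)) e.
by rewrite mul0r subr0.
Qed.

Definition regular_off_e0 (f : pt -> K) := forall P, P <> e0 -> exists c, value P c f.

Lemma x_regular : regular_off_e0 xf.
Proof.
by move=> P; case: (pt_cases P) => [//|->|->|iP] _; [exists 0; apply: value_e1_x
  | exists 0; apply: value_e2_x | exists (xf P); apply: value_x_inner].
Qed.

Lemma e1_neq_e0 : e1 <> e0.
Proof.
move=> E; have [m m0 [_ E1 _]] := proj_coordsE e0P; have [k k0 [_ E1' _]] := proj_coordsE e1P.
by move: k0; rewrite -[k]mulr1 -E1' E E1 mulr0 eqxx.
Qed.

Lemma e2_neq_e0 : e2 <> e0.
Proof.
move=> E; have [m m0 [_ _ E1]] := proj_coordsE e0P; have [k k0 [_ _ E1']] := proj_coordsE e2P.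
by move: k0; rewrite -[k]mulr1 -E1' E E1 mulr0 eqxx.
Qed.

(** So a zero of a denominator in u is met at a point of the curve other than
    e0. *)
Lemma u_surjective c : exists2 P, P <> e0 & value P c uf.
Proof.
have [->|u0] := eqVneq c 0; first by exists e1; [exact: e1_neq_e0|]; apply: value_e1_u.
have [->|u1] := eqVneq c (-1); first by exists e2; [exact: e2_neq_e0|]; apply: value_e2_u.
have [x m] := model_ex u0 u1; have [P [iP _ _ <-]] := model_inner m.
by exists P; [have [] := inner_neq iP | apply: value_u_inner].
Qed.

Lemma value_horner P c f (p : {poly K}) : value P c f -> value P p.[c] (fun Q => p.[f Q]).
Proof.
move=> V; have := @value_sum P (size p) (fun i => p`_i * c ^+ i) (fun i Q => p`_i * f Q ^+ i).
move=> /(_ (fun i _ => value_mul (value_cst _ _) (value_exp i V))) W.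
apply: (value_eq W); last by rewrite horner_coef.
by apply: generic_true => Q; rewrite horner_coef.
Qed.

Lemma generic_horner_neq0 (p : {poly K}) : p != 0 -> generic (fun Q => p.[uf Q] != 0).
Proof.
move/closed_nonrootP => [c]; have [P _ V] := u_surjective c.
exact: value_neq0_generic (value_horner p V).
Qed.

Lemma generic_horner_inj (p p' : {poly K}) : generic (fun Q => p.[uf Q] = p'.[uf Q]) -> p = p'.
Proof.
move=> G; apply/eqP; rewrite -subr_eq0; apply/contraT => /generic_horner_neq0 G'.
have [Q [e]] := generic_ex (generic_and G G').
by rewrite hornerD hornerN e subrr eqxx.
Qed.

(** Write f = a/b with forms a and b.  After multiplication by a suitable power
    of x, averaging turns b into a nonzero polynomial in u, and f into a fraction
    A(u)/B(u), which may be taken reduced; a zero of B would be a pole of f at a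
    point other than e0. *)
Lemma invariant_is_poly_u f : regular_off_e0 f ->
  generic (fun Q => f (sg Q) = f Q) -> exists p : {poly K}, generic (fun Q => f Q = p.[uf Q]).
Proof.
move=> reg inv.
have invs s : generic (fun Q => f (sigma_it s Q) = f Q).
  elim: s => [|s IH]; first exact: generic_true.
  by apply: generic_mono2 IH (generic_aut (sigma_it s) inv) _ => Q E1 E2; rewrite sigma_itS E2.
have [B [A [B0 AB]]] : exists B A : {poly K}, B != 0 /\ generic (fun Q => f Q * B.[uf Q] = A.[uf Q]).
  have [c [n [a [b [ha hb b0 _ G]]]]] : exists c, value e2 c f.
    exact: reg e2_neq_e0.
  have [|i [B [B0 BE]]] := @nonzero_component (form_poly b).
    have [P [iP bP]] : exists P : pt, inner P /\ feval b (ccoords P) != 0.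
      by apply: (nonzero_inner hb); exists e2.
    have [k k0 kE] := feval_inner hb iP.
    exists (xf P), (uf P); split; first exact: inner_model.
    by move: bP; rewrite kE mulf_eq0 negb_or => /andP[].
  have [A [AE _]] := orbit_average ('X^i * form_poly a).
  exists B, A; split=> //.
  pose rel s Q := f Q * eval2 ('X^i * form_poly b) (xf (sigma_it s Q)) (uf Q) = eval2 ('X^i * form_poly a) (xf (sigma_it s Q)) (uf Q).
  have Grel s : generic (rel s).
    apply: generic_mono2 (generic_and (invs s) (generic_aut (sigma_it s) G)) generic_inner _ => Q [fE E] iQ.
    have iQ' := inner_sigma_it s iQ; move: E; rewrite fE.
    have [k k0 kE] : exists2 k, k != 0 & forall h, h \is n.-homog ->
       feval h (ccoords (sigma_it s Q)) = k * eval2 (form_poly h) (xf (sigma_it s Q)) (uf (sigma_it s Q)).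
      have [k k0 kE] := inner_coords_u iQ'; exists (k ^+ n); rewrite ?expf_neq0 // => h hh.
      by rewrite eval2_form_poly kE (feval_scale _ _ hh).
    rewrite !kE // mulrCA uf_sigma_it => /(mulfI k0) E.
    by rewrite /rel /eval2 !hornerM mulrCA; congr (_ * _).
  have Gall n' : generic (fun Q => forall s, (s < n')%N -> rel s Q).
    elim: n' => [|n' IH]; first exact: generic_true.
    apply: generic_mono2 IH (Grel n') _ => Q E E' s; rewrite ltnS leq_eqVlt => /orP[/eqP->|] //.
    exact: E.
  apply: generic_mono2 (Gall N) generic_inner _ => Q E iQ.
  have [_ _ m] := inner_model iQ; rewrite -(BE _ _ m) -(AE _ _ m) mulr_sumr.
  by apply: eq_bigr => s _; rewrite -xf_sigma_it E.
pose D := gcdp A B.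
have D0 : D != 0 by rewrite gcdp_eq0 negb_and B0 orbT.
pose A' := A %/ D; pose B' := B %/ D.
have AE : A = A' * D by rewrite divpK // dvdp_gcdl.
have BE : B = B' * D by rewrite divpK // dvdp_gcdr.
have cop : coprimep A' B' by rewrite coprimep_div_gcd // B0 orbT.
have AB' : generic (fun Q => f Q * B'.[uf Q] = A'.[uf Q]).
  apply: generic_mono2 AB (generic_horner_neq0 D0) _ => Q.
  by rewrite {1}AE {1}BE !hornerM mulrA => E /mulIf; apply.
have B'0 : B' != 0 by apply: contraNneq B0 => z; rewrite BE z mul0r.
have [/size_poly1P[c c0 cE] | /closed_rootP[c rB]] := boolP (size B' == 1%N).
  exists (c^-1 *: A'); apply: generic_mono AB' _ => Q; rewrite cE hornerC => E.
  by rewrite hornerZ -E mulrC mulfK.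
have [P Pe V] := u_surjective c; have [d Vf] := reg P Pe.
have := value_uniq (value_generic (value_mul Vf (value_horner B' V)) AB') (value_horner A' V).
move/rootP: rB => rB; rewrite rB mulr0 => /esym/rootP rA.
by have := coprimep_root cop rA; rewrite rB eqxx.
Qed.

(** 1/u vanishes at e0, so p(u)/u^deg p takes the leading coefficient of p there. *)
Lemma degree_bound (p : {poly K}) n : value e0 0 (fun Q => p.[uf Q] / uf Q ^+ n) ->
  (size p <= n)%N.
Proof.
move=> V; rewrite leqNgt; apply/negP => np.
have p0 : p != 0 by rewrite -size_poly_gt0 (leq_trans _ np).
pose D := (size p).-1.
have VL : value e0 (lead_coef p) (fun Q => p.[uf Q] / uf Q ^+ D).
  have W := @value_sum e0 (size p) (fun i => p`_i * 0 ^+ (D - i))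
     (fun i Q => p`_i * (uf Q)^-1 ^+ (D - i)).
  apply: (value_eq_inner (W (fun i _ => value_mul (value_cst _ _) (value_exp _ value_e0_uV)))).
    move=> Q iQ; have [u0 _ _] := inner_model iQ.
    rewrite horner_coef mulr_suml; apply: eq_bigr => i _; rewrite -mulrA; congr (_ * _).
    have iD : (i <= D)%N by rewrite -ltnS /D prednK ?ltn_ord ?size_poly_gt0.
    by rewrite -[in LHS](subnKC iD) exprD invfM mulrA divff ?expf_neq0 // mul1r exprVn.
  have sp : (0 < size p)%N by rewrite size_poly_gt0.
  have lD : (D < size p)%N by rewrite /D prednK.
  rewrite (bigD1 (Ordinal lD)) //= subnn expr0 mulr1 lead_coefE big1 ?addr0 // => i iD.
  have : (i < D)%N.
    rewrite ltn_neqAle -ltnS {2}/D prednK // ltn_ord andbT.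
    by apply: contraNneq iD => iD; apply/eqP/val_inj.
  by rewrite expr0n subn_eq0 ltnNge => /negPf->; rewrite mulr0.
have nD : (n <= D)%N by rewrite -ltnS /D prednK // size_poly_gt0.
have := value_uniq VL (value_eq_inner (value_mul V (value_exp (D - n) value_e0_uV)) _ (erefl _)).
rewrite mul0r => E; have : lead_coef p != 0 by rewrite lead_coef_eq0.
rewrite E ?eqxx // => Q iQ; have [u0 _ _] := inner_model iQ.
by rewrite -[in LHS](subnKC nD) exprD invfM mulrA exprVn.
Qed.

Lemma mup_bound (p : {poly K}) P a c n : p != 0 -> value P a uf ->
  value P c (fun Q => p.[uf Q] / (uf Q - a) ^+ n) -> (n <= mup a p)%N.
Proof.
move=> p0 Vu V; rewrite leqNgt; apply/negP => lt.
have [m [p' /implyP/(_ p0) r pE]] := multiplicity_XsubC p a.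
have mE : mup a p = m.
  rewrite pE mupMr // ?mup_XsubCX ?eqxx //.
rewrite mE in lt.
have G : generic (fun Q => uf Q - a != 0).
  by have := generic_horner_neq0 (negbT (polyXsubC_eq0 a)) => G; apply: generic_mono G _ => Q; rewrite hornerXsubC.
have V0 : value P 0 (fun Q => uf Q - a) by apply: value_cast (value_sub Vu (value_cst _ _)) _; rewrite subrr.
have := value_uniq (value_eq (value_mul V (value_exp (n - m) V0)) _ (erefl _)) (value_horner p' Vu).
rewrite expr0n subn_eq0 leqNgt lt mulr0 => E; move/rootP: r; apply; rewrite E //.
apply: generic_mono G _ => Q z; rewrite pE hornerM horner_exp hornerXsubC.
rewrite -{1}(subnKC (ltnW lt)) exprD invfM mulrA mulfK ?expf_neq0 //.
by rewrite divfK ?expf_neq0.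
Qed.

(** * Local parameters *)

Definition diff_quot (t : pt -> K) c f Q := (f Q - c) / t Q.

Definition diffable P t c (f : pt -> K) := value P c f /\ exists d, value P d (diff_quot t c f).

(** The maximal ideal of the local ring at [P] is generated by [t].  The
    statement by difference quotients makes it enough to check coordinate
    functions, by the rules of differentiation. *)
Definition local_param P t := [/\ value P 0 t, generic (fun Q => t Q != 0) &
  forall f c, value P c f -> exists d, value P d (diff_quot t c f)].

Lemma diffable_gen P t c f g : diffable P t c f -> generic (fun Q => f Q = g Q) -> diffable P t c g.
Proof.
case=> V [d W] G; split; first exact: value_generic V G.
by exists d; apply: value_generic W _; apply: generic_mono G _ => Q E; rewrite /diff_quot E.
Qed.

Lemma diffable_cst P t c : diffable P t c (fun=> c).
Proof.
split; first exact: value_cst; exists 0; apply: value_eq (value_cst P 0) _ _ => //.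
by apply: generic_true => Q; rewrite /diff_quot subrr mul0r.
Qed.

Lemma diffable_add P t c d f g : diffable P t c f -> diffable P t d g ->
  diffable P t (c + d) (fun Q => f Q + g Q).
Proof.
move=> [V [c' V']] [W [d' W']]; split; first exact: value_add.
exists (c' + d'); apply: value_eq (value_add V' W') _ _ => //.
by apply: generic_true => Q; rewrite /diff_quot -mulrDl; congr (_ * _); ring.
Qed.

Lemma diffable_mul P t c d f g : diffable P t c f -> diffable P t d g ->
  diffable P t (c * d) (fun Q => f Q * g Q).
Proof.
move=> [V [c' V']] [W [d' W']]; split; first exact: value_mul.
exists (c' * d + c * d').
apply: value_eq (value_add (value_mul V' W) (value_mul (value_cst P c) W')) _ _ => //.
by apply: generic_true => Q; rewrite /diff_quot; ring.
Qed.

Lemma diffable_inv P t c f : diffable P t c f -> c != 0 ->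
  diffable P t c^-1 (fun Q => (f Q)^-1).
Proof.
move=> [V [c' V']] c0; split; first exact: value_inv.
exists (- (c' / (c * c))).
have W := value_div V' (value_mul (value_cst P c) V) (mulf_neq0 c0 c0).
apply: value_eq (value_opp W) _ _ => //.
apply: generic_mono (value_neq0_generic V c0) _ => Q fQ; rewrite /diff_quot.
have -> : (f Q)^-1 - c^-1 = - ((f Q - c) / (c * f Q)) by field; rewrite c0 fQ.
by rewrite mulNr mulrAC.
Qed.

Lemma diffable_exp P t c f n : diffable P t c f -> diffable P t (c ^+ n) (fun Q => f Q ^+ n).
Proof.
move=> V; elim: n => [|n IH]; first by rewrite expr0; apply: diffable_cst.
rewrite exprS; apply: diffable_gen (diffable_mul V IH) _.
by apply: generic_true => Q; rewrite exprS.
Qed.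

Lemma diffable_meval P t (k : 'I_3 -> pt -> K) (d : 'I_3 -> K) (a : {mpoly K[3]}) :
  (forall i, diffable P t (d i) (k i)) ->
  diffable P t a.@[d] (fun Q => a.@[fun i => k i Q]).
Proof.
move=> h; elim/mpolyind: a => [|c m p _ _ IH].
  rewrite meval0; apply: diffable_gen (diffable_cst P t 0) _.
  by apply: generic_true => Q; rewrite meval0.
rewrite mevalD mevalZ mevalX.
suff hm : diffable P t (\prod_(i < 3) d i ^+ m i) (fun Q => \prod_(i < 3) k i Q ^+ m i).
  apply: diffable_gen (diffable_add (diffable_mul (diffable_cst P t c) hm) IH) _.
  by apply: generic_true => Q; rewrite mevalD mevalZ mevalX.
rewrite !big_ord_recl big_ord0.
apply: diffable_gen (diffable_mul (diffable_exp _ (h _)) (diffable_mul (diffable_exp _ (h _))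
  (diffable_mul (diffable_exp _ (h _)) (diffable_cst P t 1)))) _.
by apply: generic_true => Q; rewrite !big_ord_recl big_ord0.
Qed.

Lemma local_param_coords P t (k : 'I_3 -> pt -> K) (d : 'I_3 -> K) :
  value P 0 t -> generic (fun Q => t Q != 0) ->
  (forall i, diffable P t (d i) (k i)) ->
  (exists2 m, m != 0 & ccoords P = m *: \row_i d i) ->
  generic (fun Q => exists2 m, m != 0 & ccoords Q = m *: \row_i k i Q) ->
  local_param P t.
Proof.
move=> V0 t0 dk [m m0 mE] G; split=> // f c V.
case: (V) => n [a [b [ha hb b0 e Gf]]].
have rE (w : 'I_3 -> K) g : feval g (\row_i w i) = g.@[w].
  by rewrite /feval; apply: meval_eq => i; rewrite mxE.
have bd : b.@[d] != 0.
  by move: b0; rewrite mE (feval_scale _ _ hb) mulf_eq0 rE negb_or => /andP[].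
have D := diffable_mul (diffable_meval a dk) (diffable_inv (diffable_meval b dk) bd).
have Gq : generic (fun Q => a.@[fun i => k i Q] * (b.@[fun i => k i Q])^-1 = f Q).
  apply: generic_mono2 (generic_and G Gf) (value_neq0_generic (diffable_meval b dk).1 bd) _ => Q [[l l0 lE] E] bQ.
  move: E; rewrite lE (feval_scale _ _ hb) (feval_scale _ _ ha) !rE mulrCA.
  by move/(mulfI (expf_neq0 n l0)) => <-; rewrite mulfK.
have [V1 [d1 V2]] := diffable_gen D Gq.
by exists d1; rewrite (value_uniq V V1).
Qed.

Lemma local_param_comp (phi : aut) P t : local_param (phi P) t ->
  local_param P (fun Q => t (phi Q)).
Proof.
case=> V0 t0 h; split; first exact: value_aut.
  exact: (generic_aut phi t0).
move=> f c V; have [|d W] := h (fun Q => f (aut_inv phi Q)) c.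
  by apply: (@value_aut (phi^-1)%g); rewrite [(phi^-1)%g _]aut_funK.
exists d; apply: value_eq (value_aut W) _ _ => //.
by apply: generic_true => Q; rewrite /diff_quot aut_funK.
Qed.

(** Each parameter is a multiple of the other, by factors with inverse values. *)
Lemma local_param_ratio P t t' : local_param P t -> local_param P t' ->
  exists2 c, c != 0 & value P c (fun Q => t' Q / t Q).
Proof.
move=> [V t0 h] [V' t0' h'].
have [c W] := h _ _ V'; have [c' W'] := h' _ _ V.
have E : c * c' = 1.
  apply: value_uniq (value_mul W W') _; apply: (value_eq (value_cst P 1)) => //.
  apply: generic_mono2 t0 t0' _ => Q z z'; rewrite /diff_quot !subr0.
  by field; rewrite z z'.
exists c; first by apply/eqP=> c0; move/eqP: E; rewrite c0 mul0r eq_sym oner_eq0.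
by apply: value_eq W _ _ => //; apply: generic_true => Q; rewrite /diff_quot subr0.
Qed.

Lemma local_param_e0 : local_param e0 zf.
Proof.
have gz : generic (fun Q => zf Q != 0).
  by apply: generic_mono generic_inner _ => Q /inner_xy[x0 y0]; rewrite mulf_neq0 ?invr_eq0.
pose k (i : 'I_3) Q := [:: 1; zf Q; (xf Q)^-1]`_i.
pose d (i : 'I_3) : K := [:: 1; 0; 0]`_i.
apply: (@local_param_coords _ _ k d) => //; first exact: value_e0_z.
- case=> [[|[|[|]]]] //= l; rewrite /k /d /=.
  + exact: diffable_cst.
  + split; first exact: value_e0_z; exists 1; apply: value_eq (value_cst _ 1) _ _ => //.
    by apply: generic_mono gz _ => Q z; rewrite /diff_quot subr0 divff.
  split; first exact: value_e0_xV.
  exists 0.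
  have VD := value_add (value_cst e0 1) (value_mul value_e0_z (value_exp q value_e0_xV)).
  rewrite mul0r addr0 in VD.
  have W := value_opp (value_div (value_exp q value_e0_z) VD (oner_neq0 _)).
  apply: value_eq W _ _; last by rewrite expr0n gtn_eqF ?mul0r ?oppr0 // (leq_trans _ q_gt2).
  apply: generic_mono2 generic_inner (value_neq0_generic VD (oner_neq0 _)) _ => Q.
  move=> /rel_split[x [y [A [B [[xE yE AE BE] [x0 y0 A0 B0 e]]]]]].
  rewrite /diff_quot /zf xE yE exprVn expr_div_n AE BE subr0 => D0.
  apply: subr0_eq; apply: (mulIf D0); rewrite mul0r opprK mulrDl divfK //.
  transitivity ((x * (y * B) + x * A + y) / (x * A * y)); last by rewrite e mul0r.
  by field; rewrite x0 y0 A0.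
- exact: e0P.
apply: generic_mono generic_inner _ => Q /and3P[a b c]; exists (c0 Q) => //.
rewrite [LHS]row3E; apply/rowP=> i; rewrite !mxE /k /zf /xf /yf -/(c0 Q) -/(c1 Q) -/(c2 Q).
by case: i => [[|[|[|]]]] //= _; field; rewrite ?a ?b ?c.
Qed.

Lemma local_param_e2 : local_param e2 xf.
Proof.
have := @local_param_comp tu e2 zf; rewrite tau_e2 => /(_ local_param_e0).
case=> V0 t0 h.
have G : generic (fun Q => zf (tu Q) = xf Q).
  apply: generic_mono generic_inner _ => Q /and3P[a b c]; rewrite /zf.
  have [-> ->] := xf_yf_coords (tau_coords (proj_coords_self Q)).
  by rewrite /xf; field; rewrite b c.
split; first exact: value_e2_x.
  by apply: generic_mono2 G t0 _ => Q ->.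
move=> f c /h [d W]; exists d; apply: value_generic W _; apply: generic_mono G _ => Q.
by rewrite /diff_quot => ->.
Qed.

Lemma local_param_e1 : local_param e1 (fun Q => (yf Q)^-1).
Proof.
have := @local_param_comp tu e1 xf; rewrite tau_e1 => /(_ local_param_e2).
case=> V0 t0 h.
have G : generic (fun Q => xf (tu Q) = (yf Q)^-1).
  apply: generic_mono generic_inner _ => Q /and3P[a b c].
  have [-> _] := xf_yf_coords (tau_coords (proj_coords_self Q)).
  by rewrite /yf invf_div.
split; first exact: value_e1_yV.
  by apply: generic_mono2 G t0 _ => Q ->.
move=> f c /h [d W]; exists d; apply: value_generic W _; apply: generic_mono G _ => Q.
by rewrite /diff_quot => ->.
Qed.

(** * Sums over S-orbits and functions with a small pole at e0 *)

Lemma sigma_it_coords s P a b c : proj_coords P a b c ->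
  proj_coords (sigma_it s P) a (lam ^+ s * b) (lam ^+ q.+1 ^+ s * c).
Proof.
move=> h; elim: s => [|s IH]; first by rewrite !mul1r.
by rewrite sigma_itS (exprS lam s) (exprS (lam ^+ q.+1)) -!mulrA; apply: sigma_coords.
Qed.

Lemma sigma_itN Q : sigma_it N Q = Q.
Proof.
apply: proj_coords_inj (sigma_it_coords N (proj_coords_self Q)) _.
by rewrite exprAC (prim_expr_order lam_prim) expr1n !mul1r; apply: proj_coords_self.
Qed.

Definition orbit_sum (g : pt -> K) Q := \sum_(s < N) g (sigma_it s Q).

Lemma orbit_sum_sigma g Q : orbit_sum g (sg Q) = orbit_sum g Q.
Proof.
have E s : sigma_it s (sg Q) = sigma_it s.+1 Q by rewrite expgSr.
rewrite /orbit_sum; under eq_bigr do rewrite E.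
have := sigma_itN Q; rewrite /N addn1 => QN.
by rewrite big_ord_recr [RHS]big_ord_recl /= QN addrC.
Qed.

Lemma orbit_sum_value g P (c : nat -> K) :
  (forall s, (s < N)%N -> value (sigma_it s P) (c s) g) -> value P (\sum_(s < N) c s) (orbit_sum g).
Proof.
move=> h; apply: (@value_sum P N c (fun s Q => g (sigma_it s Q))) => s sN.
exact: value_aut (h s sN).
Qed.

Lemma sigma_it_neq_e0 s P : P <> e0 -> sigma_it s P <> e0.
Proof. by move=> h E; apply: h; apply: (can_inj (aut_funK (sigma_it s))); rewrite E sigma_it_e0. Qed.

Lemma orbit_sum_regular g : regular_off_e0 g -> regular_off_e0 (orbit_sum g).
Proof.
move=> reg P Pe.
have /choice[c cP] s : exists c, value (sigma_it s P) c g by apply/reg/sigma_it_neq_e0.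
by exists (\sum_(s < N) c s); apply: orbit_sum_value => s _.
Qed.

Lemma mup_exp (p : {poly K}) a n : p != 0 -> mup a (p ^+ n) = (n * mup a p)%N.
Proof.
move=> p0; elim: n => [|n IH]; first by rewrite expr0 mupNroot ?root1.
by rewrite exprS mupM ?expf_neq0 // IH mulSn.
Qed.

Lemma mup_add_lt_size (p : {poly K}) a b : p != 0 -> a != b -> (mup a p + mup b p < size p)%N.
Proof.
move=> p0 ab; have d : ('X - a%:P) ^+ mup a p * ('X - b%:P) ^+ mup b p %| p.
  rewrite Gauss_dvdp; first by rewrite -!mup_geq ?leqnn.
  by rewrite coprimep_expl // coprimep_expr // coprimep_XsubC2 // subr_eq0 eq_sym.
have := dvdp_leq p0 d.
by rewrite size_mul ?expf_neq0 ?polyXsubC_eq0 // !size_exp_XsubC addnS.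
Qed.

Lemma inner_xN Q : inner Q -> xf Q ^+ N = - uf Q ^+ q * (1 + uf Q).
Proof. by move/inner_model => [_ _ ->]; rewrite branchE. Qed.

(** Let N A = q j + a and N B = j + b.  The bounds give a + b <= q, while
    a - q b = N (A - q B) is a multiple of N smaller than N in absolute value, so
    it is zero; hence b = 0 and N divides j. *)
Lemma no_intermediate_order j A B D : (0 < j < N)%N -> (q * j <= N * A)%N -> (j <= N * B)%N ->
  (A + B <= D)%N -> (N * D < q.+1 * j.+1)%N -> False.
Proof.
move=> /andP[j0 jN] hA hB hD hN.
have [a aE] : exists a, (N * A = q * j + a)%N by exists (N * A - q * j)%N; lia.
have [b bE] : exists b, (N * B = j + b)%N by exists (N * B - j)%N; lia.
have ab : (a + b <= q)%N by have := leq_mul (leqnn N) hD; rewrite mulnDr; lia.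
have E : (N * A + q * b = N * (q * B) + a)%N by rewrite mulnCA bE aE; lia.
have qb : (q * b <= q * q)%N by rewrite leq_mul //; lia.
have NE : (N = q * q + q + 1)%N by rewrite /N; lia.
have [lt|lt|AE] := ltngtP A (q * B).
- by have := leq_mul (leqnn N) lt; rewrite mulnS; lia.
- by have := leq_mul (leqnn N) lt; rewrite mulnS; lia.
have aqb : (a = q * b)%N by move: E; rewrite AE; lia.
have b0 : b = 0%N.
  case: b ab aqb {bE E qb} => // b ab aqb; move: ab; rewrite aqb mulnS; lia.
case: B bE {hB hD AE E} => [|B] bE; first by rewrite muln0 in bE; lia.
by move: bE; rewrite mulnS; lia.
Qed.

(** The j-th eigencomponent of f is x^-j p_j(u).  It has no pole at e1 and e2,
    where x has orders q and 1, so p_j has zeros of order at least q j / N at 0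
    and j / N at -1; its pole at e0 is smaller than that of x, which bounds the
    degree of p_j.  By [no_intermediate_order] only p_0 remains, and the same
    bound makes it constant. *)
Lemma constant_of_pole f : regular_off_e0 f ->
  value e0 0 (fun Q => f Q / xf Q) -> exists c, generic (fun Q => f Q = c).
Proof.
move=> reg V0.
pose chi j := orbit_sum (fun Q => xf Q ^+ j * f Q).
have /choice[p pE] j : exists p : {poly K}, generic (fun Q => chi j Q = p.[uf Q]).
  apply: invariant_is_poly_u; last by apply: generic_true => Q; apply: orbit_sum_sigma.
  apply: orbit_sum_regular => P Pe.
  have [c Vx] := x_regular Pe; have [d Vf] := reg _ Pe.
  by exists (c ^+ j * d); apply: (value_mul (value_exp j Vx) Vf).
have fE : generic (fun Q => f Q = \sum_(j < N) xf Q ^- j * (p j).[uf Q]).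
  have Gall n : generic (fun Q => forall j, (j < n)%N -> chi j Q = (p j).[uf Q]).
    elim: n => [|n IH]; first exact: generic_true.
    apply: generic_mono2 IH (pE n) _ => Q E E' j; rewrite ltnS leq_eqVlt => /orP[/eqP->|] //.
    exact: E.
  apply: generic_mono2 (Gall N) generic_inner _ => Q E iQ; have [x0 _] := inner_xy iQ.
  under eq_bigr do rewrite -E //.
  rewrite /chi /orbit_sum.
  under eq_bigr do rewrite mulr_sumr.
  rewrite exchange_big /=.
  transitivity (\sum_(s < N) (N %| s)%N%:R * f (sigma_it s Q)).
    have Nne : (0 < N)%N by rewrite /N addn1.
    rewrite (bigD1 (Ordinal Nne)) //= dvdn0 mul1r big1 ?addr0 // => s s0.
    have s_gt0 : (0 < s)%N by rewrite lt0n; apply: contraNneq s0 => i0; apply/eqP/val_inj.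
    by rewrite gtnNdvd // mul0r.
  apply: eq_bigr => s _; rewrite -sum_root_unity mulr_suml; apply: eq_bigr => j _.
  rewrite xf_sigma_it (exprMn j (zeta ^+ s)) (exprAC zeta s j).
  move: (zeta ^+ j ^+ s) (expf_neq0 j x0) => Z; move: (xf Q ^+ j) => X X0.
  by field.
have size_p j : p j != 0 -> (N * (size (p j)).-1 < q.+1 * j.+1)%N.
  move=> pj; have : (size (p j ^+ N) <= q.+1 * j.+1)%N.
    apply: degree_bound.
    have V1 : value e0 0 (fun Q => (p j).[uf Q] / xf Q ^+ j.+1).
      have Vs s : value e0 0 (fun Q => f (sigma_it s Q) / xf (sigma_it s Q)).
        by apply: (@value_aut (sigma_it s) e0 0 (fun Q => f Q / xf Q)); rewrite sigma_it_e0.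
      have W := @value_sum e0 N _ _ (fun s _ => value_mul (value_cst e0 ((zeta ^+ s) ^+ j.+1)) (Vs s)).
      apply: (value_eq W); last by apply: big1 => s _; rewrite mulr0.
      apply: generic_mono2 (pE j) generic_inner _ => Q <- iQ.
      have [x0 _] := inner_xy iQ.
      rewrite /chi /orbit_sum mulr_suml; apply: eq_bigr => s _.
      have z0 : zeta ^+ s != 0 by rewrite !expf_neq0 // (lam_neq0 lam_prim).
      rewrite xf_sigma_it (exprMn j (zeta ^+ s)) !(exprS _ j).
      move: (zeta ^+ s) z0 => z z0; have zj := expf_neq0 j z0; have xj := expf_neq0 j x0.
      move: (z ^+ j) (xf Q ^+ j) zj xj => Z X Z0 X0; field.
      by rewrite x0 X0 z0.
    have V2 : value e0 (-1) (fun Q => xf Q ^+ N / uf Q ^+ q.+1).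
      apply: (value_eq_inner (value_opp (value_add (value_cst e0 1) value_e0_uV))); last by rewrite addr0.
      move=> Q iQ; have [u0 _ _] := inner_model iQ; rewrite inner_xN // exprSr.
      by field; rewrite u0 expf_neq0.
    apply: (value_eq_inner (value_mul (value_exp N V1) (value_exp j.+1 V2))).
      move=> Q iQ; have [x0 _] := inner_xy iQ; rewrite horner_exp.
      rewrite [(_ / xf Q ^+ _) ^+ _]expr_div_n [(_ / uf Q ^+ _) ^+ _]expr_div_n -!exprM.
      by rewrite [(j.+1 * N)%N]mulnC mulrA divfK ?expf_neq0.
    by rewrite expr0n /N addn1 mul0r.
  have sz : (0 < size (p j ^+ N))%N by rewrite size_poly_gt0 expf_neq0.
  by rewrite -[size _]prednK // size_exp mulnC.
have Vzero P j : P <> e0 -> sg P = P -> exists c, value P c (fun Q => (p j).[uf Q] / xf Q ^+ j).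
  move=> Pe fixP; have {}fixP s : sigma_it s P = P.
    by elim: s => [|s IH] //; rewrite sigma_itS IH.
  have [c V] := reg P Pe.
  have Vs s : value P c (fun Q => f (sigma_it s Q)).
    by apply: (@value_aut (sigma_it s) P c f); rewrite fixP.
  have W := @value_sum P N _ _ (fun s _ => value_mul (value_cst P ((zeta ^+ s) ^+ j)) (Vs s)).
  exists (\sum_(s < N) zeta ^+ s ^+ j * c); apply: (value_eq W) => //.
  apply: generic_mono2 (pE j) generic_inner _ => Q <- iQ.
  have [x0 _] := inner_xy iQ.
  rewrite /chi /orbit_sum mulr_suml; apply: eq_bigr => s _.
  rewrite xf_sigma_it (exprMn j (zeta ^+ s)); have xj := expf_neq0 j x0.
  by rewrite mulrAC mulfK.
have ord_p P j a m (h : {poly K}) : P <> e0 -> sg P = P -> value P a uf -> p j != 0 -> h.[a] != 0 ->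
    (forall Q, inner Q -> xf Q ^+ N = (uf Q - a) ^+ m * h.[uf Q]) -> (m * j <= N * mup a (p j))%N.
  move=> Pe fixP Vu pj h0 hE; have [c V] := Vzero P j Pe fixP.
  have W := value_mul (value_exp N V) (value_exp j (value_horner h Vu)).
  rewrite -mup_exp //; apply: mup_bound (expf_neq0 _ pj) Vu (value_eq_inner W _ (erefl _)) => Q iQ.
  have [x0 _] := inner_xy iQ; have xN := expf_neq0 N x0.
  have E := hE Q iQ; move: xN; rewrite E mulf_eq0 negb_or => /andP[a0 h1].
  rewrite horner_exp [(_ / xf Q ^+ _) ^+ _]expr_div_n (exprAC (xf Q) j N) E.
  rewrite exprM (exprMn j ((uf Q - a) ^+ m)).
  have := expf_neq0 j a0; have := expf_neq0 j h1.
  move: (((uf Q - a) ^+ m) ^+ j) (h.[_] ^+ j) (_ ^+ N) => X Y Z y0 z0; field; by rewrite y0 z0.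
have p_zero j : (0 < j < N)%N -> p j = 0.
  move=> jN; apply/eqP/contraT => pj.
  have [//|||] := @no_intermediate_order j (mup 0 (p j)) (mup (-1) (p j)) (size (p j)).-1 jN; last exact: size_p.
  - apply: (ord_p e1 j 0 q (- (1 + 'X))) e1_neq_e0 sigma_e1 value_e1_u pj _ _.
      by rewrite !hornerE oppr_eq0 oner_neq0.
    by move=> Q iQ; rewrite inner_xN // subr0 !hornerE mulNr mulrN.
  - have := ord_p e2 j (-1) 1%N (- 'X^q) e2_neq_e0 sigma_e2 value_e2_u pj; rewrite mul1n; apply.
      by rewrite hornerN hornerXn oppr_eq0 expf_neq0 // oppr_eq0 oner_neq0.
    by move=> Q iQ; rewrite inner_xN // opprK expr1 hornerN hornerXn mulrC addrC.
  by rewrite -ltnS prednK ?size_poly_gt0 // mup_add_lt_size // eq_sym oppr_eq0 oner_neq0.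
have fE' : generic (fun Q => f Q = (p 0%N).[uf Q]).
  have Nne : (0 < N)%N by rewrite /N addn1.
  apply: generic_mono fE _ => Q ->; rewrite (bigD1 (Ordinal Nne)) //= expr0 invr1 mul1r.
  rewrite big1 ?addr0 // => j j0; rewrite p_zero ?horner0 ?mulr0 // ltn_ord andbT lt0n.
  by apply: contraNneq j0 => j0; apply/eqP/val_inj.
have [p0|p0] := eqVneq (p 0%N) 0.
  by exists 0; apply: generic_mono fE' _ => Q ->; rewrite p0 horner0.
have /size_poly1P[c _ pc] : size (p 0%N) == 1%N.
  have := size_p _ p0; rewrite muln1; have : (0 < size (p 0%N))%N by rewrite size_poly_gt0.
  case: (size (p 0%N)) => [|[|n]] //= _; rewrite /N; nia.
by exists c; apply: generic_mono fE' _ => Q ->; rewrite pc hornerC.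
Qed.

(** * Automorphisms that fix e0 *)

Definition vertex P := [\/ P = e0, P = e1 | P = e2].

Lemma vertexP P : vertex P \/ inner P.
Proof. by case: (pt_cases P); [left; apply: Or31|left; apply: Or32|left; apply: Or33|right]. Qed.

Lemma aut_inj (phi : aut) : injective phi.
Proof. exact: can_inj (aut_funK phi). Qed.

Lemma inner_eq P Q : inner P -> inner Q -> xf P = xf Q -> uf P = uf Q -> P = Q.
Proof.
move=> iP iQ ex eu; apply: proj_coords_inj (inner_coords_u iP) _.
by rewrite ex eu; apply: inner_coords_u.
Qed.

Lemma generic_x_neq0 : generic (fun Q => xf Q != 0).
Proof. by apply: generic_mono generic_inner _ => Q /inner_xy[]. Qed.
Lemma generic_y_neq0 : generic (fun Q => yf Q != 0).
Proof. by apply: generic_mono generic_inner _ => Q /inner_xy[]. Qed.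

(** An automorphism carries local parameters to local parameters, so x o phi
    has at P the pole that x has at e0, of order exactly q+1. *)
Lemma pole_of_x_aut P (phi : aut) t : local_param P t -> phi P = e0 ->
  exists2 c, c != 0 & value P c (fun Q => xf (phi Q) * t Q ^+ q.+1).
Proof.
move=> lt E; have lz : local_param P (fun Q => zf (phi Q)).
  by apply: local_param_comp; rewrite E; apply: local_param_e0.
have [c c0 V] := local_param_ratio lt lz.
have [_ t0 _] := lt; have [_ z0 _] := lz.
have V1 : value P (-1) (fun Q => xf (phi Q) * zf (phi Q) ^+ q.+1).
  by apply: (@value_aut phi P _ (fun Q => xf Q * zf Q ^+ q.+1)); rewrite E; apply: value_e0_xz.
have cq := expf_neq0 q.+1 c0.
exists (-1 / c ^+ q.+1); first by rewrite mulf_neq0 ?invr_eq0 // oppr_eq0 oner_neq0.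
apply: (value_eq (value_div V1 (value_exp q.+1 V) cq)) => //.
apply: generic_mono2 t0 z0 _ => Q tQ zQ; rewrite [(_ / t Q) ^+ _]expr_div_n.
have := expf_neq0 q.+1 tQ; have := expf_neq0 q.+1 zQ.
by move: (zf (phi Q) ^+ q.+1) (t Q ^+ q.+1) => Z T Z0 T0; field; rewrite Z0 T0.
Qed.

(** The value a of x o phi / x at e0 makes the pole of x o phi - a x smaller than
    that of x, so this difference is constant; and it is zero at e1. *)
Lemma fix_e0_x (phi : aut) : phi e0 = e0 -> vertex (phi e1) ->
  exists2 a, a != 0 & generic (fun Q => xf (phi Q) = a * xf Q).
Proof.
move=> h0 h1; have [c cn V] := pole_of_x_aut local_param_e0 h0.
have Va : value e0 (- c) (fun Q => xf (phi Q) / xf Q).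
  have n1 : -1 != 0 :> K by rewrite oppr_eq0 oner_neq0.
  apply: (value_eq (value_div V value_e0_xz n1)); last by rewrite invrN1 mulrN1.
  have [_ z0 _] := local_param_e0.
  apply: generic_mono2 generic_x_neq0 z0 _ => Q x0 z; have := expf_neq0 q.+1 z.
  by move: (zf Q ^+ q.+1) => Z Z0; field; rewrite x0 Z0.
exists (- c); first by rewrite oppr_eq0.
have [P Pe||k kE] := @constant_of_pole (fun Q => xf (phi Q) - (- c) * xf Q).
- have [d Vd] := x_regular Pe.
  have [|d' Vd'] := @x_regular (phi P); first by move=> E; apply: Pe; apply: (@aut_inj phi); rewrite E h0.
  by exists (d' - (- c) * d); apply: value_sub (value_aut Vd') (value_mul (value_cst _ _) Vd).
- apply: (value_eq (value_sub Va (value_cst e0 (- c)))); last by rewrite subrr.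
  by apply: generic_mono generic_x_neq0 _ => Q x0; rewrite mulrBl mulfK.
suff k0 : k = 0 by apply: generic_mono kE _ => Q; rewrite k0 => /eqP; rewrite subr_eq0 => /eqP.
have V1 : value (phi e1) 0 xf.
  have : phi e1 <> e0 by rewrite -h0 => /(@aut_inj phi); apply: e1_neq_e0.
  by case: h1 => // -> _; [apply: value_e1_x | apply: value_e2_x].
have := value_uniq (value_generic (value_sub (value_aut V1) (value_mul (value_cst e1 (- c)) value_e1_x)) kE) (value_cst _ _).
by move=> <-; rewrite mulr0 subr0.
Qed.

(** Otherwise phi maps e1 to e2, and x o phi vanishes to order 1 at e1, whereas
    a x vanishes to order q. *)
Lemma fix_e0_e1 (phi : aut) : phi e0 = e0 -> vertex (phi e1) -> phi e1 = e1.
Proof.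
move=> h0 h1; have [a a0 xE] := fix_e0_x h0 h1; case: h1 => // E.
  by case: e1_neq_e0; apply: (@aut_inj phi); rewrite E h0.
have lx : local_param e1 (fun Q => xf (phi Q)).
  by apply: local_param_comp; rewrite E; apply: local_param_e2.
have [c c0 V] := local_param_ratio local_param_e1 lx.
have V1 : value e1 (-1) (fun Q => - 1 - uf Q).
  by apply: value_cast (value_sub (value_cst _ _) value_e1_u) _; rewrite subr0.
have W := value_mul (value_mul (value_cst e1 a) V1) (value_exp q.-1 value_e1_yV).
case/eqP: c0; apply: (value_uniq V); apply: (value_eq W); last first.
  by rewrite expr0n (_ : (q.-1 == 0)%N = false) ?mulr0 //; case: (q) q_gt2 => [|[|]].
apply: generic_mono2 xE generic_inner _ => Q ->.
move=> iQ; have [x0 y0] := inner_xy iQ; have uE := inner_uE iQ.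
have -> : -1 - uf Q = xf Q * yf Q ^+ q by rewrite -opprD uE opprK.
move: (xf Q) (yf Q) x0 y0 => x y x0 y0.
have qE : q = q.-1.+1 by rewrite prednK // ltnW // ltnW.
rewrite {1}qE exprSr exprVn invrK -!mulrA; congr (_ * (_ * _)).
by rewrite [RHS]mulrCA divff ?mulr1 // expf_neq0.
Qed.

(** Here x o phi = a x and y o phi = g y, and the equation of the curve becomes
    a polynomial identity in u that gives g = a^(q+1) and a^N = 1. *)
Lemma fix_e0_sigma_it (phi : aut) : phi e0 = e0 -> (forall P, vertex P -> vertex (phi P)) ->
  exists k, phi = sigma_it k.
Proof.
move=> h0 hv.
have h1 : phi e1 = e1 by apply: fix_e0_e1 h0 (hv e1 _); apply: Or32.
have h2 : phi e2 = e2.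
  have e21 : e2 <> e1.
    move=> E; have [m m0 [_ _ E1]] := proj_coordsE e1P; have [k k0 [_ _ E1']] := proj_coordsE e2P.
    by move: k0; rewrite -[k]mulr1 -E1' E E1 mulr0 eqxx.
  case: (hv e2 (Or33 _ _ (erefl _))) => // E.
    by case: e2_neq_e0; apply: (@aut_inj phi); rewrite E h0.
  by case: e21; apply: (@aut_inj phi); rewrite E h1.
have inn P : inner P -> inner (phi P).
  move=> iP; case: (vertexP (phi P)) => // - [] E; have [n0 n1 n2] := inner_neq iP.
  - by case: n0; apply: (@aut_inj phi); rewrite E h0.
  - by case: n1; apply: (@aut_inj phi); rewrite E h1.
  by case: n2; apply: (@aut_inj phi); rewrite E h2.
have [a a0 xE] := fix_e0_x h0 (hv e1 (Or32 _ _ (erefl _))).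
have giy : generic (fun Q => yf (phi Q) != 0) by exact: (generic_aut phi generic_y_neq0).
have gix : generic (fun Q => xf (phi Q) != 0) by exact: (generic_aut phi generic_x_neq0).
pose r Q := yf (phi Q) / yf Q.
have r0 : exists c, value e0 c r.
  have lz : local_param e0 (fun Q => zf (phi Q)).
    by apply: local_param_comp; rewrite h0; apply: local_param_e0.
  have [c _ V] := local_param_ratio local_param_e0 lz.
  exists (c * a); apply: (value_eq (value_mul V (value_cst e0 a))) => //.
  apply: generic_mono2 (generic_and gix xE) generic_inner _ => Q [x' E] iQ; have [x0 y0] := inner_xy iQ.
  have -> : a = xf (phi Q) / xf Q by rewrite E mulfK.
  by rewrite /r /zf; field; rewrite x0 y0 x'.
have r1 : exists c, value e1 c r.
  have ly : local_param e1 (fun Q => (yf (phi Q))^-1).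
    by apply: (@local_param_comp phi e1 (fun Q => (yf Q)^-1)); rewrite h1; apply: local_param_e1.
  have [c c0 V] := local_param_ratio local_param_e1 ly.
  exists c^-1; apply: (value_eq (value_inv V c0)) => //.
  by apply: generic_true => Q; rewrite /r; move: (yf _) (yf _) => A B; rewrite invf_div invrK mulrC.
have r2 : exists c, value e2 c r.
  have n1 : -1 != 0 :> K by rewrite oppr_eq0 oner_neq0.
  have V : value e2 (-1) (fun Q => uf (phi Q)).
    by apply: (@value_aut phi e2); rewrite h2; apply: value_e2_u.
  exists (a ^+ q.+1 * (-1 / -1)).
  apply: (value_eq (value_mul (value_cst e2 (a ^+ q.+1)) (value_div value_e2_u V n1))) => //.
  apply: generic_mono2 (generic_and (generic_and giy gix) xE) generic_inner _ => Q [[y' x'] E] iQ.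
  have [x0 y0] := inner_xy iQ; rewrite /r /uf E (exprMn q.+1 a).
  have := expf_neq0 q.+1 a0; have := expf_neq0 q.+1 x0.
  by move: (xf Q ^+ q.+1) (a ^+ q.+1) => X A X0 A0; field; rewrite y' y0 X0 A0.
have rreg P : exists c, value P c r.
  have [[]->//|iP] := vertexP P; have [_ y0] := inner_xy iP.
  exists (yf (phi P) / yf P); apply: value_div y0; last exact: value_y_inner.
  by apply: value_aut; apply/value_y_inner/inn.
have [g gE] : exists g, generic (fun Q => yf (phi Q) = g * yf Q).
  have [|g gE] := @constant_of_pole r (fun P _ => rreg P).
    by have [c V] := r0; apply: (value_eq (value_mul V value_e0_xV)); [apply: generic_true | rewrite mulr0].
  exists g; apply: generic_mono2 gE generic_y_neq0 _ => Q <- y0; by rewrite /r divfK.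
have [gE1 gE2] : a ^+ q.+1 = a * g ^+ q.+1 /\ g = a * g ^+ q.+1.
  have : (a ^+ q.+1 - a * g ^+ q.+1)%:P * 'X + (g - a * g ^+ q.+1)%:P = 0.
    apply: generic_horner_inj; apply: generic_mono2 (generic_and xE gE) generic_inner _ => Q [Ex Ey] iQ.
    rewrite hornerD hornerMX !hornerC; have := inner_rel (inn Q iQ); rewrite Ex Ey (exprMn _ a) (exprMn _ g).
    have [x0 y0] := inner_xy iQ.
    have uE : xf Q ^+ q.+1 = uf Q * yf Q by rewrite /uf divfK.
    have vE : xf Q * yf Q ^+ q.+1 = - (1 + uf Q) * yf Q by rewrite inner_uE // opprK exprSr mulrA.
    rewrite mulrACA vE uE; move: (a ^+ q.+1) (g ^+ q.+1) (uf Q) (yf Q) y0 => A G u y y0 e.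
    by apply: (mulIf y0); rewrite mul0r -e; ring.
  move=> e; have := congr1 (fun p : {poly K} => p`_1) e; have := congr1 (fun p : {poly K} => p`_0) e.
  rewrite !coefD !coefMX !coefC /= add0r addr0 ?coef0 => E0 E1.
  by split; apply: subr0_eq.
have gA : g = a ^+ q.+1 by rewrite gE1.
have aN : a ^+ N = 1.
  apply: (mulIf (expf_neq0 q.+1 a0)); rewrite mul1r {2}gE1 gA -exprM -exprS -exprD.
  by congr (_ ^+ _); rewrite /N; lia.
have [k aE] := prim_rootP zeta_prim aN.
exists k; apply: curve_autP => Q.
have [[]->|iQ] := vertexP Q; rewrite ?sigma_it_e0 ?sigma_it_e1 ?sigma_it_e2 //.
apply: inner_eq; [exact: inn | exact: inner_sigma_it | rewrite xf_sigma_it -aE | rewrite uf_sigma_it].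
  apply: value_uniq (value_aut (value_x_inner (inn _ iQ))) _.
  apply: (value_eq (value_mul (value_cst Q a) (value_x_inner iQ))) => //; exact: xE.
apply: value_uniq (value_aut (value_u_inner (inn _ iQ))) _.
apply: (value_eq (value_u_inner iQ)) => //.
apply: generic_mono2 (generic_and xE gE) generic_inner _ => P [Ex Ey] iP.
have [x0 y0] := inner_xy iP.
by rewrite /uf Ex Ey gA (exprMn _ a) -mulf_div divff ?mul1r // expf_neq0.
Qed.

(** * Automorphisms permute the vertices *)

Section InnerPreimage.
Variables (phi : aut) (P0 : pt).
Hypothesis iP0 : inner P0.
Hypothesis phiP0 : phi P0 = e0.

Let x0 := xf P0.
Let y0 := yf P0.
Let u0 := uf P0.
Let xi Q := xf Q - x0.
Let eta Q := yf Q - y0.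

(** The derivative of y with respect to x at P0. *)
Let slope := - (y0 / x0) / u0.
Let tangent Q := - (y0 / x0) * xi Q - u0 * eta Q.

Let x0_neq0 : x0 != 0. Proof. by case: (inner_xy iP0). Qed.
Let y0_neq0 : y0 != 0. Proof. by case: (inner_xy iP0). Qed.
Let u0_neq0 : u0 != 0. Proof. by case: (inner_model iP0). Qed.

Let q_split : exists2 n, q = n.+2 & (0 < n)%N.
Proof. by case: (q) q_gt2 => [|[|[|n]]] // _; exists n.+1. Qed.

Let xi_neq0 : generic (fun Q => xi Q != 0).
Proof.
have V : value e0 1 (fun Q => xi Q / xf Q).
  apply: (value_eq (value_sub (value_cst e0 1) (value_mul (value_cst e0 x0) value_e0_xV))).
    by apply: generic_mono generic_x_neq0 _ => Q x_; rewrite /xi mulrBl divff.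
  by rewrite mulr0 subr0.
by apply: generic_mono (value_neq0_generic V (oner_neq0 _)) _ => Q; rewrite mulf_eq0 negb_or => /andP[].
Qed.

Let value_xi : value P0 0 xi.
Proof. by apply: value_cast (value_sub (value_x_inner iP0) (value_cst _ x0)) _; rewrite subrr. Qed.
Let value_eta : value P0 0 eta.
Proof. by apply: value_cast (value_sub (value_y_inner iP0) (value_cst _ y0)) _; rewrite subrr. Qed.

Let base_rel : y0 * y0 ^+ q + x0 ^+ q = - (y0 / x0) /\ x0 * y0 ^+ q + 1 = - u0.
Proof.
have := inner_rel iP0; have := inner_uE iP0; rewrite -/x0 -/y0 -/u0 !exprS => E1 E2.
split.
  apply: (mulfI x0_neq0); rewrite mulrN mulrCA divff // mulr1.
  by apply/eqP; rewrite -addr_eq0 -E2; apply/eqP; ring.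
by apply: oppr_inj; rewrite opprK opprD -E1; ring.
Qed.

(** As xi^q and eta^q are x^q - x0^q and y^q - y0^q, up to order q the equation
    of the curve is that of a conic with quadratic part y0^q xi eta, whose tangent
    has contact of order 2 only. *)
Let tangent_eq Q : inner Q -> tangent Q =
  - (y0 ^+ q * xi Q * eta Q) - xf Q * yf Q * eta Q ^+ q - xf Q * xi Q ^+ q.
Proof.
move=> iQ; have [E1 E2] := base_rel; have := inner_rel iQ; have := inner_rel iP0.
rewrite /tangent -E1 -[u0]opprK -E2 /xi /eta !frobeniusB -/x0 -/y0 !exprS.
move: (xf Q) (yf Q) => x y; move: (x ^+ q) (y ^+ q) (x0 ^+ q) (y0 ^+ q) => A B X Y F0 FQ.
by apply: subr0_eq; rewrite -[RHS](subrr 0) -{1}FQ -F0; ring.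
Qed.

(** The equation of the curve, solved for eta/xi, has this denominator. *)
Let slope_den Q := - u0 + y0 ^+ q * xi Q + xf Q * yf Q * eta Q ^+ q.-1.

Let value_den : value P0 (- u0) slope_den.
Proof.
have V := value_add (value_add (value_cst P0 (- u0)) (value_mul (value_cst P0 (y0 ^+ q)) value_xi))
  (value_mul (value_mul (value_x_inner iP0) (value_y_inner iP0)) (value_exp q.-1 value_eta)).
have [n qE n0] := q_split.
by apply: value_cast V _; rewrite qE expr0n /= !mulr0 !addr0.
Qed.

Let value_slope : value P0 slope (fun Q => eta Q / xi Q).
Proof.
have d0 : - u0 != 0 by rewrite oppr_eq0.
have V := value_div (value_sub (value_cst P0 (y0 / x0)) (value_mul (value_x_inner iP0) (value_exp q.-1 value_xi)))
  value_den d0.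
have [n qE n0] := q_split.
apply: (value_eq V); last by rewrite qE expr0n /= mulr0 subr0 /slope invrN mulrN mulNr.
apply: generic_mono2 (generic_and xi_neq0 (value_neq0_generic value_den d0)) generic_inner _ => Q [xQ dQ] iQ.
have := tangent_eq iQ; rewrite /tangent.
have ePE : eta Q ^+ q = eta Q * eta Q ^+ q.-1 by rewrite -exprS prednK // qE.
have xPE : xi Q ^+ q = xi Q * xi Q ^+ q.-1 by rewrite -exprS prednK // qE.
rewrite ePE xPE => E.
apply: (mulIf xQ); rewrite divfK // mulrAC; apply: (mulIf dQ); rewrite divfK //.
move: E dQ; rewrite /slope_den.
move: (eta Q ^+ q.-1) (xi Q ^+ q.-1) (eta Q) (xi Q) (y0 ^+ q) (y0 / x0) (xf Q) (yf Q).
move=> E1 X1 e x Y k a b E _; apply: subr0_eq.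
by rewrite -(subrr (- k * x - u0 * e)) {2}E; ring.
Qed.

Let param_xi : local_param P0 xi.
Proof.
pose k (i : 'I_3) Q := [:: xf Q; yf Q; 1]`_i.
pose d (i : 'I_3) : K := [:: x0; y0; 1]`_i.
apply: (@local_param_coords _ _ k d) => //.
- case=> [[|[|[|]]]] //= l; rewrite /k /d /=.
  + split; first exact: value_x_inner; exists 1; apply: value_eq (value_cst _ 1) _ _ => //.
    by apply: generic_mono xi_neq0 _ => Q z; rewrite /diff_quot divff.
  + by split; [exact: value_y_inner | exists slope].
  exact: diffable_cst.
- by have [m m0 mE] := inner_coords_xy iP0; exists m.
by apply: generic_mono generic_inner _ => Q /inner_coords_xy.
Qed.

Let value_u_xi : value P0 (- y0 ^+ q) (fun Q => (uf Q - u0) / xi Q).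
Proof.
have V := value_div (value_sub (value_add (value_cst P0 (x0 ^+ q))
  (value_mul (value_x_inner iP0) (value_exp q.-1 value_xi))) (value_mul (value_cst P0 u0) value_slope))
  (value_y_inner iP0) y0_neq0.
have [n qE n0] := q_split.
apply: (value_eq V).
  apply: generic_mono2 xi_neq0 generic_inner _ => Q xQ iQ; have [_ yQ] := inner_xy iQ.
  have E1 : uf Q * yf Q = xf Q * (x0 ^+ q + xi Q * xi Q ^+ q.-1).
    by rewrite /uf divfK // -exprS prednK ?qE // -qE /xi frobeniusB addrC subrK exprS.
  have E0 : u0 * y0 = x0 * x0 ^+ q by rewrite /u0 /uf divfK ?exprS.
  move: xQ yQ E1 E0; rewrite /eta /xi.
  move: (xf Q) (yf Q) (uf Q) ((_ - _) ^+ q.-1) (x0 ^+ q) => x y u Xp X xQ yQ E1 E0.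
  apply: subr0_eq; transitivity (((u * y - x * (X + (x - x0) * Xp)) - (u0 * y0 - x0 * X)) / ((x - x0) * y)).
    by field; rewrite xQ yQ.
  by rewrite E1 E0 !subrr mul0r.
have [E1 E2] := base_rel.
rewrite qE expr0n /= mulr0 addr0 -qE; apply: (mulIf y0_neq0); rewrite divfK //.
rewrite /slope mulrCA divff // mulr1 -E1; ring.
Qed.

Let slope_neq0 : slope != 0.
Proof. by rewrite /slope !mulf_neq0 ?invr_eq0 // oppr_eq0 mulf_neq0 ?invr_eq0. Qed.

Let value_tangent_xi : value P0 (- (y0 ^+ q * slope)) (fun Q => tangent Q / xi Q ^+ 2).
Proof.
have [n qE n0] := q_split.
have V := value_sub (value_sub (value_opp (value_mul (value_cst P0 (y0 ^+ q)) value_slope))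
  (value_mul (value_mul (value_mul (value_x_inner iP0) (value_y_inner iP0)) (value_exp q value_slope)) (value_exp n value_xi)))
  (value_mul (value_x_inner iP0) (value_exp n value_xi)).
apply: (value_eq V); last by rewrite expr0n gtn_eqF // !mulr0 !subr0.
apply: generic_mono2 xi_neq0 generic_inner _ => Q xQ iQ.
rewrite tangent_eq // [(eta Q / xi Q) ^+ _]expr_div_n; have := expf_neq0 n xQ; rewrite qE !exprS.
move: (xi Q) (eta Q) (xf Q) (yf Q) (xi Q ^+ n) (eta Q ^+ n) (y0 ^+ n) xQ.
by move=> a b x y A B Y a0 A0; field; rewrite a0 A0.
Qed.

Let pole_xi : exists2 c, c != 0 & value P0 c (fun Q => xf (phi Q) * xi Q ^+ q.+1).
Proof. exact: pole_of_x_aut param_xi phiP0. Qed.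

(** With [e] below, 2 k + e = q and k + e <= q - 1. *)
Let k := q./2.
Let e : nat := odd q.
Let k_gt0 : (0 < k)%N. Proof. by rewrite half_gt0 ltnW. Qed.
Let qke : q = (k + k + e)%N.
Proof. by rewrite addnn addnC odd_double_half. Qed.

Let exp_qke (a : K) : a ^+ q = a ^+ k * a ^+ k * a ^+ e.
Proof. by rewrite -!exprD -qke. Qed.

(** The tangent vanishes to order 2 at P0 and xi to order 1, so the product in
   the middle has order q, against the pole of order q+1 of x o phi. *)
Let psi Q := (uf Q - u0) * xf (phi Q) * (tangent Q ^+ k * xi Q ^+ e) * xf Q.

Let value_psi_P0 : exists2 w, w != 0 & value P0 w psi.
Proof.
have [c cn Vc] := pole_xi.
have V := value_mul (value_mul (value_mul value_u_xi Vc) (value_exp k value_tangent_xi)) (value_x_inner iP0).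
exists (- y0 ^+ q * c * (- (y0 ^+ q * slope)) ^+ k * x0).
  have yq : y0 ^+ q != 0 by rewrite expf_neq0.
  apply: mulf_neq0 x0_neq0; apply: mulf_neq0; first by rewrite mulf_neq0 // oppr_eq0.
  by rewrite expf_neq0 // oppr_eq0 mulf_neq0.
apply: (value_eq V) => //; apply: generic_mono xi_neq0 _ => Q xQ.
rewrite /psi [(_ / xi Q ^+ 2) ^+ _]expr_div_n -exprM mul2n -addnn exprS exprD exp_qke.
have := expf_neq0 k xQ; have := expf_neq0 e xQ.
move: (tangent Q ^+ k) (xi Q ^+ k) (xi Q ^+ e) (xf (phi Q)) (uf Q - u0) => T A B f v A0 B0.
by field; rewrite xQ B0.
Qed.

Let value_tangent P cx cy : value P cx xf -> value P cy yf ->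
  value P (- (y0 / x0) * (cx - x0) - u0 * (cy - y0)) tangent.
Proof.
move=> Vx Vy; apply: value_sub; apply: value_mul; try exact: value_cst.
  exact: value_sub Vx (value_cst _ _).
exact: value_sub Vy (value_cst _ _).
Qed.

Let value_phi P : P <> P0 -> exists c, value P c (fun Q => xf (phi Q)).
Proof.
move=> PP; have [|c V] := @x_regular (phi P); last by exists c; apply: value_aut.
by rewrite -phiP0 => /(@aut_inj phi).
Qed.

Let value_psi_inner P : inner P -> P <> P0 -> exists c, value P ((uf P - u0) * c) psi.
Proof.
move=> iP PP; have [f Vf] := value_phi PP.
have Vx := value_x_inner iP; have Vy := value_y_inner iP.
have VT := value_tangent Vx Vy; have Vxi := value_sub Vx (value_cst P x0).
have V := value_mul (value_mul (value_mul (value_sub (value_u_inner iP) (value_cst P u0)) Vf)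
  (value_mul (value_exp k VT) (value_exp e Vxi))) Vx.
by eexists; apply: (value_eq V); [exact: generic_true | rewrite -!mulrA].
Qed.

Let nP0 : [/\ e0 <> P0, e1 <> P0 & e2 <> P0].
Proof. by have [n0 n1 n2] := inner_neq iP0; split=> h; [apply: n0|apply: n1|apply: n2]. Qed.

Let value_psi_e1 : value e1 0 psi.
Proof.
have [_ n1 _] := nP0; have [f Vf] := value_phi n1.
have Vxi : value e1 0 (fun Q => xi Q / yf Q).
  apply: (value_eq_inner (value_sub value_e1_xy (value_mul (value_cst e1 x0) value_e1_yV))); last by rewrite mulr0 subr0.
  by move=> Q _; rewrite /xi mulrBl.
have Veta : value e1 1 (fun Q => eta Q / yf Q).
  apply: (value_eq_inner (value_sub (value_cst e1 1) (value_mul (value_cst e1 y0) value_e1_yV))); last by rewrite mulr0 subr0.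
  by move=> Q /inner_xy[_ yQ]; rewrite /eta mulrBl divff.
have VT := value_sub (value_mul (value_cst e1 (- (y0 / x0))) Vxi) (value_mul (value_cst e1 u0) Veta).
have Vv : value e1 (-1) (fun Q => - 1 - uf Q).
  by apply: value_cast (value_sub (value_cst _ _) value_e1_u) _; rewrite subr0.
have V := value_mul (value_mul (value_mul (value_sub value_e1_u (value_cst e1 u0)) Vf)
  (value_mul (value_exp k VT) (value_exp e Vxi))) (value_mul Vv (value_exp k value_e1_yV)).
apply: (value_eq_inner V); last by rewrite [0 ^+ k]expr0n gtn_eqF // !mulr0.
move=> Q iQ; have [xQ yQ] := inner_xy iQ; rewrite /psi.
have -> : -1 - uf Q = xf Q * yf Q ^+ q by rewrite -opprD inner_uE // opprK.
rewrite exp_qke /tangent.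
rewrite -[- (y0 / x0) * (_ / _) - _](_ : (- (y0 / x0) * xi Q - u0 * eta Q) / yf Q = _); last by ring.
rewrite [(_ / yf Q) ^+ k]expr_div_n [(_ / yf Q) ^+ e]expr_div_n exprVn; have := expf_neq0 k yQ; have := expf_neq0 e yQ.
move: ((_ - _) ^+ k) (xi Q ^+ e) (yf Q ^+ k) (yf Q ^+ e) (xf Q) (uf Q - u0) (xf (phi Q)).
by move=> T X A B x v g B0 A0; field; rewrite A0 B0.
Qed.

Let value_psi_e2 : value e2 0 psi.
Proof.
have [_ _ n2] := nP0; have [f Vf] := value_phi n2.
have VT := value_tangent value_e2_x value_e2_y; have Vxi := value_sub value_e2_x (value_cst e2 x0).
have V := value_mul (value_mul (value_mul (value_sub value_e2_u (value_cst e2 u0)) Vf)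
  (value_mul (value_exp k VT) (value_exp e Vxi))) value_e2_x.
by apply: (value_eq V); [exact: generic_true | rewrite mulr0].
Qed.

Let value_psi_e0 : value e0 0 (fun Q => psi Q / uf Q ^+ 2).
Proof.
have [n0 _ _] := nP0; have [f Vf] := value_phi n0.
have Vxi : value e0 1 (fun Q => xi Q / xf Q).
  apply: (value_eq_inner (value_sub (value_cst e0 1) (value_mul (value_cst e0 x0) value_e0_xV))); last by rewrite mulr0 subr0.
  by move=> Q /inner_xy[xQ _]; rewrite /xi mulrBl divff.
have Veta : value e0 0 (fun Q => eta Q / xf Q).
  apply: (value_eq_inner (value_sub value_e0_z (value_mul (value_cst e0 y0) value_e0_xV))); last by rewrite mulr0 subr0.
  by move=> Q _; rewrite /eta mulrBl.
have VT := value_sub (value_mul (value_cst e0 (- (y0 / x0))) Vxi) (value_mul (value_cst e0 u0) Veta).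
have Vu : value e0 1 (fun Q => (uf Q - u0) / uf Q).
  apply: (value_eq_inner (value_sub (value_cst e0 1) (value_mul (value_cst e0 u0) value_e0_uV))); last by rewrite mulr0 subr0.
  by move=> Q /inner_model[uQ _ _]; rewrite mulrBl divff.
have V := value_mul (value_mul (value_mul Vu Vf)
  (value_mul (value_exp k VT) (value_exp e Vxi))) (value_mul value_e0_z (value_exp k.-1 value_e0_xV)).
apply: (value_eq_inner V); last by rewrite mul0r mulr0.
move=> Q iQ; have [xQ yQ] := inner_xy iQ; have [uQ _ _] := inner_model iQ; rewrite /psi.
rewrite -[- (y0 / x0) * (_ / _) - _](_ : tangent Q / xf Q = _); last by rewrite /tangent; ring.
have zE : zf Q = xf Q ^+ q / uf Q.
  by rewrite /zf /uf exprS; move: (expf_neq0 q xQ); move: (xf Q ^+ q) => A A0; field; rewrite xQ yQ A0.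
rewrite zE exp_qke [(_ / xf Q) ^+ k]expr_div_n [(_ / xf Q) ^+ e]expr_div_n exprVn.
have kE : xf Q ^+ k = xf Q * xf Q ^+ k.-1 by rewrite -exprS prednK.
rewrite kE; have := expf_neq0 k.-1 xQ; have := expf_neq0 e xQ.
move: (tangent Q ^+ k) (xi Q ^+ e) (xf Q ^+ k.-1) (xf Q ^+ e) (xf Q) (uf Q) (xf (phi Q)) xQ uQ.
by move=> T X A B x v g x1 v1 B1 A1; field; rewrite x1 v1 A1 B1.
Qed.

(** The sum of psi over the orbits of S is a polynomial in u.  At P0 its value
    is that of psi at P0, because u - u0 vanishes at the other points of the
    orbit, where x o phi has no pole. *)
Lemma inner_preimage_absurd : False.
Proof.
have [w w0 Vw] := value_psi_P0.
pose theta := orbit_sum psi.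
have [P Pe||p pE] := @invariant_is_poly_u theta.
- apply: orbit_sum_regular Pe => {}P Pe.
  have [[] E|iP] := vertexP P; first by case: Pe.
  - by exists 0; rewrite E.
  - by exists 0; rewrite E.
  have [->|PP] := EM (P = P0); first by exists w.
  by have [c V] := value_psi_inner iP PP; eexists; exact: V.
- by apply: generic_true => Q; apply: orbit_sum_sigma.
have root_at P : (forall s, sigma_it s P = P) -> value P 0 psi -> forall a, value P a uf -> p.[a] = 0.
  move=> fixP V a Va; have W : value P (\sum_(s < N) 0) theta.
    by apply: (@orbit_sum_value psi P (fun=> 0)) => s _; rewrite fixP.
  by rewrite (value_uniq (value_horner p Va) (value_generic W pE)) big1.
have r0 := root_at _ sigma_it_e1 value_psi_e1 _ value_e1_u.
have r1 := root_at _ sigma_it_e2 value_psi_e2 _ value_e2_u.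
have sp : (size p <= 2)%N.
  apply: degree_bound; have W : value e0 (\sum_(s < N) 0) (orbit_sum (fun Q => psi Q / uf Q ^+ 2)).
    by apply: (@orbit_sum_value _ e0 (fun=> 0)) => s _; rewrite sigma_it_e0; apply: value_psi_e0.
  apply: (value_eq W); last by rewrite big1.
  apply: generic_mono pE _ => Q <-; rewrite /theta /orbit_sum mulr_suml.
  by apply: eq_bigr => s _; rewrite uf_sigma_it.
have p0 : p = 0.
  apply/eqP/contraT => p0.
  have n01 : 0 != -1 :> K by rewrite eq_sym oppr_eq0 oner_neq0.
  have := leq_trans (mup_add_lt_size p0 n01) sp; rewrite ltnS leqNgt -addn1 leq_add //.
    by rewrite mup_geq // expr1 dvdp_XsubCl; apply/rootP.
  by rewrite mup_geq // expr1 dvdp_XsubCl; apply/rootP.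
pose c s := if s == 0%N then w else 0.
have W : value P0 (\sum_(s < N) c s) theta.
  apply: (@orbit_sum_value psi P0 c) => -[|s] sN; first exact: Vw.
  have iS : inner (sigma_it s.+1 P0) by apply: inner_sigma_it.
  have [|d V] := value_psi_inner iS.
    move=> /(congr1 (fun Q => xf Q)); rewrite xf_sigma_it -[RHS]mul1r => /(mulIf x0_neq0)/eqP.
    rewrite -(prim_order_dvd zeta_prim) => d.
    by have := dvdn_leq (ltn0Sn s) d; rewrite leqNgt sN.
  by move: V; rewrite uf_sigma_it subrr mul0r.
have cE : \sum_(s < N) c s = w.
  have Nne : (0 < N)%N by rewrite /N addn1.
  rewrite (bigD1 (Ordinal Nne)) //= big1 ?addr0 // => s s0; rewrite /c ifN //.
have := value_uniq W (value_generic (value_cst P0 0) _); rewrite cE => w0'.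
by move: w0; rewrite w0' ?eqxx //; apply: generic_mono pE _ => Q ->; rewrite p0 horner0.
Qed.

End InnerPreimage.

(** * The automorphism group *)

Lemma aut_vertex_e0 (phi : aut) : vertex (phi e0).
Proof.
case: (vertexP (phi e0)) => // iP; case: (inner_preimage_absurd (phi := (phi^-1)%g) iP).
exact: (aut_funK phi e0).
Qed.

Lemma aut_vertex (phi : aut) P : vertex P -> vertex (phi P).
Proof.
case=> ->; first exact: aut_vertex_e0.
  by rewrite -tau_e0; apply: (aut_vertex_e0 (phi * tu)%g).
by rewrite -tau_e1 -tau_e0; apply: (aut_vertex_e0 (phi * (tu * tu))%g).
Qed.

Lemma stabiliser_e0 (phi : aut) : phi e0 = e0 -> exists k, phi = sigma_it k.
Proof. by move=> h; apply: fix_e0_sigma_it h (aut_vertex phi). Qed.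

Lemma sigma_fixes_vertex (phi : aut) P : cyclic_subgroup sg phi -> vertex P -> phi P = P.
Proof.
move=> [n E] vP; have sP : sigma_it n P = P by case: vP => ->; rewrite ?sigma_it_e0 ?sigma_it_e1 ?sigma_it_e2.
case: E => -> //; rewrite -{1}sP; exact: (aut_funK (sigma_it n) P).
Qed.

Lemma tau3 : (tu ^+ 3)%g = 1%g :> aut.
Proof. by apply: curve_autP => P; apply: proj_coords_inj (tau_coords (tau_coords (tau_coords (proj_coords_self P)))) (proj_coords_self P). Qed.

Lemma tau_fix_e0 n : (tu ^+ n)%g e0 = e0 -> (tu ^+ n)%g = 1%g :> aut.
Proof.
rewrite (divn_eq n 3) expgnDr mulnC expgnA tau3 expg1n mul1g.
have := ltn_mod n 3; case: (n %% 3)%N => [|[|[|]]] //= _.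
  by move=> E; case: e1_neq_e0; rewrite -tau_e0; exact: E.
by move=> E; case: e2_neq_e0; rewrite -tau_e1 -tau_e0; exact: E.
Qed.

Lemma subgroup_cyclic (G : groupType) (x : G) : subgroup (cyclic_subgroup x).
Proof.
split; first by exists 0%N; left.
have inv y : cyclic_subgroup x y -> cyclic_subgroup x y^-1%g.
  by move=> [n [] ->]; exists n; [right | left; rewrite invgK].
have mul n m : cyclic_subgroup x (x ^+ n * x ^- m)%g /\ cyclic_subgroup x (x ^- m * x ^+ n)%g.
  have [/subnK <-|/ltnW/subnK <-] := leqP m n.
    split; exists (n - m)%N; left; first by rewrite expgnDr mulgK.
    by rewrite addnC expgnDr mulKg.
  split; exists (m - n)%N; right; first by rewrite expgnDr invgM mulVKg.
  by rewrite addnC expgnDr invgM mulgVK.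
move=> y z hy /inv hz; move: (z^-1)%g hz => {}z hz.
case: hy hz => n [] -> [m [] ->].
- by exists (n + m)%N; left; rewrite expgnDr.
- by case: (mul n m).
- by case: (mul m n).
by exists (m + n)%N; right; rewrite expgnDr invgM.
Qed.

(** Since S is the stabiliser of e0 and fixes every vertex, while automorphisms
    permute the vertices, S is normal; and a power of tau corrects the image of
    e0. *)
Lemma pellikaan_semidirect : semidirect (cyclic_subgroup sg) (cyclic_subgroup tu).
Proof.
have sgC k : cyclic_subgroup sg (sigma_it k) by exists k; left.
split; try exact: subgroup_cyclic.
- move=> x g hx; have [|k ->] := @stabiliser_e0 (x ^ g)%g; last exact: sgC.
  have E : x (g e0) = g e0 by apply: sigma_fixes_vertex hx (aut_vertex_e0 g).
  by rewrite conjgE; change (aut_inv g (x (g e0)) = e0); rewrite E aut_funK.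
- move=> x hx; have xe : x e0 = e0 by apply: sigma_fixes_vertex hx (Or31 _ _ (erefl _)).
  move=> [n [] E]; first by rewrite E; apply: tau_fix_e0; rewrite -E.
  have xE : (tu ^+ n)%g = (x^-1)%g :> aut by rewrite E invgK.
  rewrite E tau_fix_e0 ?invg1 // xE -{1}xe; exact: aut_funK.
move=> g; have [j jE] : exists j, (g^-1)%g e0 = (tu ^+ j)%g e0.
  case: (aut_vertex_e0 (g^-1)%g) => ->; first by exists 0%N.
    by exists 1%N; rewrite -tau_e0.
  by exists 2%N; rewrite -tau_e1 -tau_e0.
have [|k kE] := @stabiliser_e0 (g * tu ^+ j)%g.
  change (g ((tu ^+ j)%g e0) = e0); rewrite -jE; exact: aut_invK.
exists (sigma_it k), (tu ^- j)%g; split; [exact: sgC | by exists j; right |].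
by rewrite -kE mulgK.
Qed.

End Curve.
Lemma finField_pchar_nat (F : finFieldType) (K : fieldType) (iota : {rmorphism F -> K}) :
  [pchar K].-nat #|F|.
Proof.
have [p pr_p pF] := finPcharP F.
have : p.-nat #|[set: F]| by apply: abelem_pgroup (fin_ring_pchar_abelem pF).
rewrite cardsT; apply: sub_in_pnat => r _; rewrite inE => /eqP ->.
by have := rmorph_pchar iota pF; rewrite !inE.
Qed.

(* [iota_alg] makes K an algebraic closure of the field F with q elements.
   For q = 2 the curve is the Klein quartic in characteristic 2, whose
   automorphism group has order 168 rather than 21. *)
Theorem theorem4p3 (F : finFieldType) (K : closedFieldType)
    (iota : {rmorphism F -> K}) (iota_alg : integralRange iota)
    (q : nat) (cardF : #|F| = q) (q_neq2 : q <> 2%N)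
    (lam : K) (lam_prim : (q ^ 2 + q + 1).-primitive_root lam) :
  semidirect (cyclic_subgroup (sigma lam_prim)) (cyclic_subgroup (tau K q)).
Proof.
apply: pellikaan_semidirect; last by rewrite -cardF; apply: finField_pchar_nat iota.
by rewrite ltn_neqAle eq_sym; apply/andP; split; [apply/eqP | rewrite -cardF finNzRing_gt1].
Qed.
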